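(* Let $n\ge 1$, let $\lambda_1,\dots,\lambda_n,\sigma_1,\dots,\sigma_n\in\mathbb C$, and put $\lambda_{n+1}=\sigma_{n+1}=0$. Assume that $\operatorname{Re}(\lambda_k-\frac{k-1}2)>0$ and $\operatorname{Re}(\sigma_k-\lambda_k-\frac{n-k}2)>0$ for $k=1,\dots,n$. Then $$\int_{T\in C_n(\mathbb R)}\prod_{j=1}^n\frac{\det [T]_j^{\lambda_j-\lambda_{j+1}}}{\det(1+[T]_j)^{\sigma_j-\sigma_{j+1}}}\,\det T^{-(n+1)/2}\,dT=\prod_{k=1}^n \pi^{(k-1)/2}\,\frac{\Gamma(\lambda_k-\frac{k-1}2)\,\Gamma(\sigma_k-\lambda_k-\frac{n-k}2)}{\Gamma(\sigma_k-\frac{n-k}2)} .$$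
   Context: $C_n(\mathbb R)$ is the cone of positive definite real symmetric $n\times n$ matrices. $[T]_j$ denotes the left upper $j\times j$ block of $T$; $\det[T]_j^{a}$ means $(\det [T]_j)^{a}$ (the determinants are positive). $dT=\prod_{k\le m}dt_{km}$ is Lebesgue measure in the entries $t_{km}$, $k\le m$, of the symmetric matrix $T$. *)

(* Defs.v *)
From HB Require Import structures.
From mathcomp Require Import all_boot all_order all_algebra.
From mathcomp Require Import complex.
From mathcomp Require Import all_classical all_reals all_analysis.
Import Order.TTheory GRing.Theory Num.Theory.
Import numFieldNormedType.Exports.

Set Implicit Arguments.
Unset Strict Implicit.
Unset Printing Implicit Defensive.

Local Open Scope classical_set_scope.
Local Open Scope ring_scope.

Section lebesgue_tuple.
Context (R : realType).

Definition rcons_pair N (p : N.-tuple (measurableTypeR R) * measurableTypeR R) :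
  N.+1.-tuple (measurableTypeR R) := [tuple of rcons p.1 p.2].

(* Lebesgue measure on R^N, as the N-fold product of the Lebesgue measure on
   R, carried over to tuples. *)
Fixpoint lebesgue_tuple (N : nat) :
    set (N.-tuple (measurableTypeR R)) -> \bar R :=
  match N with
  | 0 => dirac [tuple]
  | N'.+1 => pushforward (@lebesgue_tuple N' \x lebesgue_measure)%E
               (@rcons_pair N')
  end.

Lemma measurable_rcons_pair N : measurable_fun setT (@rcons_pair N).
Proof.
apply/measurable_fun_tnthP => i.
have [iN|iN] := ltnP i N.
  rewrite (_ : _ \o _ = (fun t => tnth t (Ordinal iN)) \o fst); last first.
    apply/funext => -[t x] /=.
    by rewrite !(tnth_nth x)/= nth_rcons size_tuple iN.
  apply: measurableT_comp => //; exact: measurable_tnth.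
rewrite (_ : _ \o _ = snd) //.
apply/funext => -[t x] /=.
have iE : nat_of_ord i = N by apply/eqP; rewrite eqn_leq iN -ltnS ltn_ord.
by rewrite (tnth_nth x)/= nth_rcons size_tuple iE ltnn eqxx.
Qed.

Let unrcons N (t : N.+1.-tuple (measurableTypeR R)) :
    N.-tuple (measurableTypeR R) * measurableTypeR R :=
  ([tuple tnth t (widen_ord (leqnSn N) i) | i < N], tnth t ord_max).

Let measurable_unrcons N : measurable_fun setT (@unrcons N).
Proof.
apply: measurable_fun_pair; last exact: measurable_tnth.
apply/measurable_fun_tnthP => i.
rewrite (_ : _ \o _ = fun t => tnth t (widen_ord (leqnSn N) i)).
  exact: measurable_tnth.
by apply/funext => t /=; rewrite tnth_mktuple.
Qed.

Let rconsK N : cancel (@rcons_pair N) (@unrcons N).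
Proof.
move=> [t x]; congr (_, _).
  apply: eq_from_tnth => i; rewrite tnth_mktuple !(tnth_nth x)/= nth_rcons.
  by rewrite size_tuple ltn_ord.
by rewrite (tnth_nth x)/= nth_rcons size_tuple ltnn eqxx.
Qed.

Let unrconsK N : cancel (@unrcons N) (@rcons_pair N).
Proof.
move=> t; apply: eq_from_tnth => i; rewrite (tnth_nth 0)/= nth_rcons.
rewrite size_tuple card_ord; case: ltnP => [iN|iN].
  have := tnth_mktuple (fun i => tnth t (widen_ord (leqnSn N) i)) (Ordinal iN).
  by rewrite (tnth_nth 0)/= => ->; congr tnth; exact: val_inj.
have iE : nat_of_ord i = N by apply/eqP; rewrite eqn_leq iN -ltnS ltn_ord.
by rewrite iE eqxx; congr tnth; apply: val_inj; rewrite /= iE.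
Qed.

Let sigma_finite_pack d (T : measurableType d) (m : set T -> \bar R) :
  m set0 = 0%E -> (forall A, 0 <= m A)%E -> semi_sigma_additive m ->
  sigma_finite setT m ->
  exists mu : {sigma_finite_measure set T -> \bar R}, m = mu.
Proof.
move=> m0 mge0 msig msf.
pose b := isMeasure.Build _ _ _ m m0 mge0 msig.
pose M : {measure set T -> \bar R} := HB.pack m b.
pose c1 := isSFinite.Build _ _ _ M (@sfinite_measure_sigma_finite _ _ _ M msf).
pose c2 := isSigmaFinite.Build _ _ _ M msf.
by exists (HB.pack_for (SigmaFiniteMeasure.type T R) (Measure.sort M) c1 c2).
Qed.

Let lebesgue_tuple_spec N :
  exists mu : {sigma_finite_measure set (N.-tuple (measurableTypeR R)) -> \bar R},
    lebesgue_tuple (N:=N) = mu.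
Proof.
elim: N => [|N [mu /= ->]].
  by exists (dirac [tuple] : {finite_measure set _ -> \bar R}).
pose nu : {measure
    set (N.-tuple (measurableTypeR R) * measurableTypeR R)%type -> \bar R} :=
  (mu \x lebesgue_measure)%E.
pose m := pushforward nu (@rcons_pair N).
have mr := @measurable_rcons_pair N.
have m0 : m set0 = 0%E by rewrite /m /pushforward preimage_set0 measure0.
have mge0 A : (0 <= m A)%E by exact: measure_ge0.
have msig : semi_sigma_additive m.
  move=> F mF tF mUF; rewrite /m /pushforward preimage_bigcup.
  apply: measure_semi_sigma_additive.
  - by move=> n; rewrite -[X in measurable X]setTI; exact: mr.
  - apply/trivIsetP => /= i j _ _ ij; rewrite -preimage_setI.
    by move/trivIsetP : tF => /(_ _ _ _ _ ij) ->//; rewrite preimage_set0.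
  - by rewrite -preimage_bigcup -[X in measurable X]setTI; exact: mr.
have msf : sigma_finite setT m.
  have [F FT Ff] : sigma_finite setT nu.
    have /sigma_finiteP[F [TF ndF Foo]] := sigma_finiteT mu.
    have /sigma_finiteP[G [TG ndG Goo]] := sigma_finiteT (@lebesgue_measure R).
    exists (fun n => F n `*` G n).
      rewrite -setXTT TF TG predeqE => -[x y]; split.
        move=> [/= [n _ Fnx] [k _ Gky]]; exists (maxn n k) => //; split.
        - by move: x Fnx; exact/subsetPset/ndF/leq_maxl.
        - by move: y Gky; exact/subsetPset/ndG/leq_maxr.
      by move=> [n _ []/= ? ?]; split; exists n.
    move=> k; have [? ?] := Foo k; have [? ?] := Goo k.
    split; first exact: measurableX.
    by rewrite /nu/= product_measure1E// lte_mul_pinfty// ge0_fin_numE.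
  exists (fun i => @unrcons N @^-1` F i).
    by rewrite -preimage_bigcup -FT preimage_setT.
  move=> i; have [mF Foo] := Ff i; split.
    by rewrite -[X in measurable X]setTI; exact: measurable_unrcons.
  rewrite /m /pushforward -comp_preimage.
  rewrite (_ : _ \o _ = id) ?preimage_id//.
  by apply/funext => t /=; rewrite rconsK.
exact: sigma_finite_pack.
Qed.

Let lebesgue_tuple0 N : @lebesgue_tuple N set0 = 0%E.
Proof. by have [mu ->] := lebesgue_tuple_spec N; exact: measure0. Qed.

Let lebesgue_tuple_ge0 N A : (0 <= @lebesgue_tuple N A)%E.
Proof. by have [mu ->] := lebesgue_tuple_spec N; exact: measure_ge0. Qed.

Let lebesgue_tuple_sigma_additive N : semi_sigma_additive (@lebesgue_tuple N).
Proof.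
by have [mu ->] := lebesgue_tuple_spec N; exact: measure_semi_sigma_additive.
Qed.

HB.instance Definition _ N := isMeasure.Build _ _ _ (@lebesgue_tuple N)
  (lebesgue_tuple0 N) (@lebesgue_tuple_ge0 N) (@lebesgue_tuple_sigma_additive N).

Let lebesgue_tuple_sigma_finite N : sigma_finite setT (@lebesgue_tuple N).
Proof. by have [mu ->] := lebesgue_tuple_spec N; exact: sigma_finiteT. Qed.

HB.instance Definition _ N := Measure_isSigmaFinite.Build _ _ _
  (@lebesgue_tuple N) (@lebesgue_tuple_sigma_finite N).

Lemma lebesgue_tuple_box N (A : 'I_N -> set (measurableTypeR R)) :
  (forall i, measurable (A i)) ->
  lebesgue_tuple [set t : N.-tuple _ | forall i, A i (tnth t i)] =
  (\prod_(i < N) lebesgue_measure (A i))%E.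
Proof.
elim: N A => [|N IH] A mA.
  rewrite big_ord0 /= diracE mem_set//=; by case.
rewrite big_ord_recr /= -IH; last by move=> i; exact: mA.
rewrite -product_measure1E//; last first.
  rewrite (_ : [set t | _] = \bigcap_(i in [set: 'I_N])
     ((fun t => tnth t i) @^-1` A (widen_ord (leqnSn N) i))); last first.
    by apply/seteqP; split => t /= tA i => [_|]; exact: tA.
  apply: fin_bigcap_measurable => // i _.
  rewrite -[X in measurable X]setTI; exact: measurable_tnth.
congr product_measure1; apply/seteqP; split => -[t x] /=.
  move=> tA; split => [i|].
    have := tA (widen_ord (leqnSn N) i).
    by rewrite !(tnth_nth x)/= nth_rcons size_tuple ltn_ord.
  by have := tA ord_max; rewrite (tnth_nth x)/= nth_rcons size_tuple ltnn eqxx.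
move=> [tA xA] i; rewrite (tnth_nth x)/= nth_rcons size_tuple.
case: ltnP => iN.
  have := tA (Ordinal iN); rewrite (tnth_nth x)/=.
  by rewrite (_ : widen_ord _ _ = i)//; exact: val_inj.
have iE : nat_of_ord i = N by apply/eqP; rewrite eqn_leq iN -ltnS ltn_ord.
by rewrite iE eqxx (_ : i = ord_max)//; exact: val_inj.
Qed.

End lebesgue_tuple.
Arguments lebesgue_tuple R N : clear implicits.

(* The entries t_(k,m), k <= m, of a symmetric matrix are listed column by
   column: t_(0,0), t_(0,1), t_(1,1), t_(0,2), ... *)
Definition sym_index (k m : nat) : nat := ('C(m.+1, 2) + k)%N.

Lemma sym_index_lt n k m : (k <= m < n)%N -> (sym_index k m < 'C(n.+1, 2))%N.
Proof.
move=> /andP[km mn]; apply: (@leq_trans 'C(m.+2, 2)).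
  by rewrite [in X in (_ < X)%N]binS bin1 /sym_index ltn_add2l ltnS.
exact: leq_bin2l.
Qed.

Lemma sym_index_inj k m k' m' : (k <= m)%N -> (k' <= m')%N ->
  sym_index k m = sym_index k' m' -> (k, m) = (k', m').
Proof.
move=> km km' e; have [lt|lt|mm] := ltngtP m m'.
- have := @sym_index_lt m' k m; rewrite km lt => /(_ erefl).
  by rewrite e /sym_index ltnNge leq_addr.
- have := @sym_index_lt m k' m'; rewrite km' lt => /(_ erefl).
  by rewrite -e /sym_index ltnNge leq_addr.
- by move: e; rewrite /sym_index mm => /addnI ->.
Qed.

Lemma sym_index_surj n p : (p < 'C(n.+1, 2))%N ->
  exists k m, (k <= m < n)%N /\ p = sym_index k m.
Proof.
elim: n => [//|n IH]; rewrite binS bin1 => pn.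
have [/IH[k [m [/andP[km mn] ->]]]|np] := ltnP p 'C(n.+1, 2).
  by exists k, m; rewrite km ltnW.
exists (p - 'C(n.+1, 2))%N, n; split; last by rewrite /sym_index subnKC.
by rewrite ltnSn andbT -ltnS ltn_subLR.
Qed.

Definition sym_matrix (R : realType) n
    (t : 'C(n.+1, 2).-tuple (measurableTypeR R)) : 'M[R]_n :=
  \matrix_(i, j) nth (0 : R) t (sym_index (minn i j) (maxn i j)).

Definition posdef_matrix (R : realType) n (T : 'M[R]_n) : Prop :=
  T^T = T /\ forall v : 'rV[R]_n, v != 0 -> 0 < (v *m T *m v^T) 0 0.

Definition posdef_cone (R : realType) n :
    set ('C(n.+1, 2).-tuple (measurableTypeR R)) :=
  [set t | posdef_matrix (sym_matrix t)].
Arguments posdef_cone R n : clear implicits.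

(* The left upper block of size j + 1. *)
Definition leading_block (R : Type) n (T : 'M[R]_n) (j : 'I_n) : 'M[R]_j.+1 :=
  mxsub (widen_ord (ltn_ord j)) (widen_ord (ltn_ord j)) T.

Section complex_analysis.
Context (R : realType).
Local Notation Re := complex.Re.
Local Notation Im := complex.Im.
Local Notation "x %:C" := (real_complex R x).

Definition cexp (z : R[i]) : R[i] :=
  Complex (expR (Re z) * cos (Im z)) (expR (Re z) * sin (Im z)).

(* The power x^a of a positive real x, for the real logarithm of x; it is
   only meaningful for 0 < x. *)
Definition cpow (x : R) (a : R[i]) : R[i] := cexp (a * (ln x)%:C).

Definition cintegrable d (T : measurableType d) (mu : {measure set T -> \bar R})
    (D : set T) (f : T -> R[i]) : Prop :=
  mu.-integrable D (fun x => (Re (f x))%:E) /\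
  mu.-integrable D (fun x => (Im (f x))%:E).

Definition cintegral d (T : measurableType d) (mu : {measure set T -> \bar R})
    (D : set T) (f : T -> R[i]) : R[i] :=
  Complex (\int[mu]_(x in D) Re (f x)) (\int[mu]_(x in D) Im (f x)).

(* Euler's integral; it is only meaningful for 0 < Re z. *)
Definition cGamma (z : R[i]) : R[i] :=
  cintegral lebesgue_measure `]0, +oo[
    (fun x => cpow x (z - 1) * (expR (- x))%:C).

End complex_analysis.

(* Main.v *)
Require Import Defs.
From HB Require Import structures.
From mathcomp Require Import all_boot all_order all_algebra.
From mathcomp Require Import complex.
From mathcomp Require Import all_classical all_reals all_analysis.
From mathcomp Require Import measurable_realfun.
From mathcomp Require Import ring lra zify.
Import Order.TTheory GRing.Theory Num.Theory.
Import numFieldNormedType.Exports.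

Set Implicit Arguments.
Unset Strict Implicit.
Unset Printing Implicit Defensive.

Local Open Scope classical_set_scope.
Local Open Scope ring_scope.
Local Open Scope complex_scope.

(** The integral is computed by removing the last column of $T$, by induction
    on $n$. Write $T$ with leading block $S$ of size $n-1$ and last column
    $(v, t)$. Then
    $\det T = \det S\,(t - vS^{-1}v^T)$ and
    $\det(1+T) = \det(1+S)\,(1 + t - v(1+S)^{-1}v^T)$.
    With $u = t - vS^{-1}v^T$, the positivity of $T$ is that of $S$ and $u$,
    and the second parenthesis is $1 + u + q(v)$, where $q$ is the quadratic
    form with matrix $S^{-1} - (1+S)^{-1} = (S + S^2)^{-1}$. The integral over
    $u$ is a Beta integral (has_cint_beta) and leaves a power of $1 + q(v)$.
    The integral of this power is computed one coordinate of $v$ at a time by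
    completing the square (tcint_qform), and it produces
    $\det(S+S^2)^{1/2} = \det S^{1/2}\det(1+S)^{1/2}$. Together
    (tcint_last_column) they give the factor of index $n$ and an integral of
    the same shape over $S$, in which $\sigma_k$ is replaced by
    $\sigma_k - 1/2$. The induction (tcint_pivot_prod) is carried out on
    products of powers of the Schur pivots, which turn the leading minors into
    independent factors and vanish outside the cone.

    Every application of Fubini's theorem needs absolute convergence. As
    $|x^a| = x^{\mathrm{Re}\,a}$ for $x > 0$, the integral of the absolute
    value is the same integral with real parameters, so each step is applied a
    second time with the real parts of the parameters. The one-dimensional
    integrals come from $\int_0^\infty t^{s-1}e^{-ct}\,dt = c^{-s}\Gamma(s)$ by
    exchanging two integrals. They are divided by values of $\Gamma$, and the
    formula of the theorem divides by such values too, so one needs that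
    $\Gamma$ has no zero in the right half-plane (cGamma_neq0). This is shown
    without an infinite product: the functional equation reduces it to large
    real parts, where $t^{z-1}e^{-t}$ is so concentrated that its phase is
    nearly constant. *)

(** * Complex powers of positive reals *)

Section complex_power.
Context {R : realType}.
Local Notation C := R[i].
Implicit Types (x y : R) (a b z : C).

Lemma Re_mul z a : complex.Re (z * a) =
  complex.Re z * complex.Re a - complex.Im z * complex.Im a.
Proof. by case: z; case: a. Qed.

Lemma Im_mul z a : complex.Im (z * a) =
  complex.Re z * complex.Im a + complex.Im z * complex.Re a.
Proof. by case: z; case: a. Qed.

Lemma Re_add z a : complex.Re (z + a) = complex.Re z + complex.Re a.
Proof. by case: z; case: a. Qed.

Lemma Im_add z a : complex.Im (z + a) = complex.Im z + complex.Im a.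
Proof. by case: z; case: a. Qed.

Lemma Re_opp z : complex.Re (- z) = - complex.Re z.
Proof. by case: z. Qed.

Lemma Im_opp z : complex.Im (- z) = - complex.Im z.
Proof. by case: z. Qed.

Lemma Re_sub z a : complex.Re (z - a) = complex.Re z - complex.Re a.
Proof. by rewrite Re_add Re_opp. Qed.

Lemma cexpD a b : cexp (a + b) = cexp a * cexp b.
Proof.
apply/eqP; rewrite eq_complex /cexp Re_mul Im_mul Re_add Im_add /= expRD cosD sinD.
by apply/andP; split; apply/eqP; ring.
Qed.

Lemma cexp0 : cexp (0 : C) = 1.
Proof. by apply/eqP; rewrite eq_complex /= expR0 cos0 sin0 mulr1 mulr0 !eqxx. Qed.

Lemma cexp_neq0 a : cexp a != 0.
Proof.
apply/eqP => a0; have := cexpD a (- a); rewrite subrr cexp0 a0 mul0r.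
by apply/eqP; rewrite oner_eq0.
Qed.

Lemma cexp_real x : cexp (x%:C) = (expR x)%:C.
Proof. by apply/eqP; rewrite eq_complex /= cos0 sin0 mulr1 mulr0 !eqxx. Qed.

Lemma norm_cexp a : `|cexp a| = cexp (complex.Re a)%:C.
Proof.
rewrite cexp_real normc_def /= !exprMn -mulrDr cos2Dsin2 mulr1 sqrtr_sqr.
by rewrite ger0_norm// expR_ge0.
Qed.

Lemma cpowD x a b : cpow x (a + b) = cpow x a * cpow x b.
Proof. by rewrite /cpow mulrDl cexpD. Qed.

Lemma cpow_x0 x : cpow x (0 : C) = 1.
Proof. by rewrite /cpow mul0r cexp0. Qed.

Lemma cpow_neq0 x a : cpow x a != 0.
Proof. exact: cexp_neq0. Qed.

Lemma cpowN x a : cpow x (- a) = (cpow x a)^-1.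
Proof.
apply: (mulIf (cpow_neq0 x a)); rewrite -cpowD addNr cpow_x0 mulVf//.
exact: cpow_neq0.
Qed.

Lemma cpowM x y a : 0 < x -> 0 < y -> cpow (x * y) a = cpow x a * cpow y a.
Proof.
by move=> x0 y0; rewrite /cpow lnM ?posrE// rmorphD mulrDr cexpD.
Qed.

Lemma cpow1l a : cpow (1 : R) a = 1.
Proof. by rewrite /cpow ln1 mulr0 cexp0. Qed.

Lemma cpowVl x a : 0 < x -> cpow x^-1 a = cpow x (- a).
Proof.
move=> x0; rewrite cpowN; apply: (mulIf (cpow_neq0 x a)).
by rewrite -cpowM ?invr_gt0// mulVf ?gt_eqF// cpow1l mulVf// cpow_neq0.
Qed.

Lemma cpow_real x y : 0 < x -> cpow x (y%:C) = (x `^ y)%:C.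
Proof.
by move=> x0; rewrite /cpow -rmorphM cexp_real /powR gt_eqF.
Qed.

Lemma cpow1 x : 0 < x -> cpow x (1 : C) = x%:C.
Proof. by move=> x0; rewrite -[1]/((1 : R)%:C) cpow_real// powRr1// ltW. Qed.

Lemma norm_cpow x a : `|cpow x a| = cpow x (complex.Re a)%:C.
Proof. by rewrite /cpow norm_cexp Re_mul/= mulr0 subr0 -rmorphM. Qed.

(** The function $x_+^a$ on the whole line, so that domains of integration need
    not be carried along. *)
Definition ppow x a : C := if 0 < x then cpow x a else 0.

Lemma ppowE x a : 0 < x -> ppow x a = cpow x a.
Proof. by rewrite /ppow => ->. Qed.

Lemma ppow_le0 x a : x <= 0 -> ppow x a = 0.
Proof. by rewrite /ppow ltNge => ->. Qed.

Lemma ppowM x y a : 0 < x -> ppow (x * y) a = cpow x a * ppow y a.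
Proof.
by move=> x0; rewrite /ppow pmulr_rgt0//; case: ifP => y0; rewrite ?mulr0// cpowM.
Qed.

Lemma norm_ppow x a : `|ppow x a| = ppow x (complex.Re a)%:C.
Proof. by rewrite /ppow; case: ifP => _; rewrite ?norm_cpow ?normr0. Qed.

Lemma norm_real x : `|x%:C| = `|x|%:C.
Proof. by rewrite normc_def /= expr0n addr0 sqrtr_sqr. Qed.

Lemma normc_ge_Im z : `|complex.Im z|%:C <= `|z|.
Proof.
have := normc_ge_Re (z * 'i%C); rewrite ReiNIm normrN normrM => /le_trans; apply.
by rewrite [X in _ * X]normc_def/= expr0n expr1n add0r sqrtr1 mulr1.
Qed.

End complex_power.

(** * Complex integrals *)

Section complex_integral.
Context {R : realType}.
Local Notation C := R[i].

Definition cmeasurable d (T : measurableType d) (f : T -> C) : Prop :=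
  measurable_fun setT (fun t => complex.Re (f t)) /\
  measurable_fun setT (fun t => complex.Im (f t)).

Section measurability.
Context d (T : measurableType d).
Implicit Types (f g : T -> C) (u : T -> R).

Lemma cmeasurableM f g : cmeasurable f -> cmeasurable g ->
  cmeasurable (fun t => f t * g t).
Proof.
move=> [f1 f2] [g1 g2]; split.
  under eq_fun do rewrite Re_mul.
  by apply: measurable_funB; exact: measurable_funM.
under eq_fun do rewrite Im_mul.
by apply: measurable_funD; exact: measurable_funM.
Qed.

Lemma cmeasurable_cst (c : C) : cmeasurable (fun _ : T => c).
Proof. by split; exact: measurable_cst. Qed.

Lemma cmeasurable_real u : measurable_fun setT u ->
  cmeasurable (fun t => (u t)%:C).
Proof. by split => //=; exact: measurable_cst. Qed.

Lemma cmeasurable_prod (I : Type) (r : seq I) (f : I -> T -> C) :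
  (forall i, cmeasurable (f i)) -> cmeasurable (fun t => \prod_(i <- r) f i t).
Proof.
move=> mf; elim: r => [|i r IH].
  under eq_fun do rewrite big_nil; exact: cmeasurable_cst.
by under eq_fun do rewrite big_cons; exact: cmeasurableM.
Qed.

Lemma cmeasurable_ppow u (a : C) : measurable_fun setT u ->
  cmeasurable (fun t => ppow (u t) a).
Proof.
move=> mu.
have mln : measurable_fun setT (fun t => ln (u t)) by exact: measurableT_comp.
have mb : measurable_fun setT (fun t => 0 < u t).
  by apply: measurable_fun_ltr => //; exact: measurable_cst.
have mM (r : R) : measurable_fun setT (fun t => r * ln (u t)).
  by apply: measurable_funM => //; exact: measurable_cst.
have mtrig (f : R -> R) : continuous f -> measurable_fun setT (fun t =>
    if 0 < u t then expR (complex.Re a * ln (u t)) * f (complex.Im a * ln (u t))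
    else 0).
  move=> cf; apply: measurable_fun_ifT => //.
  apply: measurable_funM; apply: measurableT_comp => //.
  exact: continuous_measurable_fun.
split.
  apply: eq_measurable_fun (mtrig _ (@continuous_cos R)) => t _.
  rewrite /ppow; case: ifP => _; last by [].
  by rewrite /cpow /cexp Re_mul Im_mul /= !mulr0 subr0 add0r.
apply: eq_measurable_fun (mtrig _ (@continuous_sin R)) => t _.
rewrite /ppow; case: ifP => _; last by [].
by rewrite /cpow /cexp Re_mul Im_mul /= !mulr0 subr0 add0r.
Qed.

Lemma cmeasurable_comp d' (T' : measurableType d') (f : T' -> C) (h : T -> T') :
  measurable_fun setT h -> cmeasurable f -> cmeasurable (fun t => f (h t)).
Proof. by move=> mh [f1 f2]; split; [exact: (measurableT_comp f1 mh)|exact: (measurableT_comp f2 mh)]. Qed.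

End measurability.

Section has_integral.
Context d (T : measurableType d) (mu : {measure set T -> \bar R}).
Implicit Types (f g : T -> C) (u : T -> R).

(** Integrability and value of a complex integral over a full space, in one
    predicate, so that both propagate through each computation step. *)
Definition has_cint f (v : C) : Prop :=
  [/\ mu.-integrable setT (fun t => (complex.Re (f t))%:E),
      mu.-integrable setT (fun t => (complex.Im (f t))%:E),
      (\int[mu]_t (complex.Re (f t))%:E = (complex.Re v)%:E)%E &
      (\int[mu]_t (complex.Im (f t))%:E = (complex.Im v)%:E)%E].

Lemma has_cint_cmeasurable f v : has_cint f v -> cmeasurable f.
Proof.
by move=> [/measurable_int/measurable_EFinP + /measurable_int/measurable_EFinP + _ _].
Qed.

Lemma has_cint_eq f g v : (forall t, f t = g t) -> has_cint f v -> has_cint g v.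
Proof. by move=> /funext ->. Qed.

Lemma has_cint_unique f v w : has_cint f v -> has_cint f w -> v = w.
Proof.
move=> [_ _ f1 f2] [_ _]; rewrite f1 f2 => -[e1] [e2].
by apply/eqP; rewrite eq_complex e1 e2 !eqxx.
Qed.

Lemma has_cintZ (c : C) f v : has_cint f v -> has_cint (fun t => c * f t) (c * v).
Proof.
move=> [f1 f2 e1 e2]; split.
- under eq_fun do rewrite Re_mul EFinB !EFinM.
  by apply: integrableB => //; exact: integrableZl.
- under eq_fun do rewrite Im_mul EFinD !EFinM.
  by apply: integrableD => //; exact: integrableZl.
- under eq_integral do rewrite Re_mul EFinB !EFinM.
  rewrite integralB//; [|exact: integrableZl..].
  by rewrite !integralZl// e1 e2 -!EFinM -EFinB Re_mul.
- under eq_integral do rewrite Im_mul EFinD !EFinM.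
  rewrite integralD//; [|exact: integrableZl..].
  by rewrite !integralZl// e1 e2 -!EFinM -EFinD Im_mul.
Qed.

Lemma has_cintB f g v w : has_cint f v -> has_cint g w ->
  has_cint (fun t => f t - g t) (v - w).
Proof.
move=> [f1 f2 e1 e2] [g1 g2 k1 k2]; split.
- by under eq_fun do rewrite Re_add Re_opp EFinB; exact: integrableB.
- by under eq_fun do rewrite Im_add Im_opp EFinB; exact: integrableB.
- by under eq_integral do rewrite Re_add Re_opp EFinB; rewrite integralB// e1 k1 Re_add Re_opp.
- by under eq_integral do rewrite Im_add Im_opp EFinB; rewrite integralB// e2 k2 Im_add Im_opp.
Qed.

Lemma has_cint0 : has_cint (fun=> 0) 0.
Proof. by split => /=; rewrite ?integral0//; exact: integrable0. Qed.

Lemma has_cint_real u r : mu.-integrable setT (EFin \o u) ->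
  (\int[mu]_t (u t)%:E = r%:E)%E -> has_cint (fun t => (u t)%:C) r%:C.
Proof. by move=> iu e; split => //=; rewrite ?integral0//; exact: integrable0. Qed.

Lemma has_cint_dom f u : cmeasurable f -> (forall t, `|f t| <= (u t)%:C) ->
  mu.-integrable setT (EFin \o u) -> exists v, has_cint f v.
Proof.
move=> [f1 f2] fu iu.
have Re_u t : `|complex.Re (f t)| <= u t.
  by rewrite -lecR; apply: le_trans (fu t); exact: normc_ge_Re.
have Im_u t : `|complex.Im (f t)| <= u t.
  by rewrite -lecR; apply: le_trans (fu t); exact: normc_ge_Im.
have int1 : mu.-integrable setT (fun t => (complex.Re (f t))%:E).
  apply: le_integrable iu => //; first exact/measurable_EFinP.
  by move=> t _; rewrite /= lee_fin (le_trans (Re_u t))// ler_norm.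
have int2 : mu.-integrable setT (fun t => (complex.Im (f t))%:E).
  apply: le_integrable iu => //; first exact/measurable_EFinP.
  by move=> t _; rewrite /= lee_fin (le_trans (Im_u t))// ler_norm.
exists (Complex (\int[mu]_t complex.Re (f t)) (\int[mu]_t complex.Im (f t))).
by split => //=; rewrite /Rintegral fineK//; exact: integrable_fin_num.
Qed.

End has_integral.

Section fubini.
Context d1 d2 (X : measurableType d1) (Y : measurableType d2).
Variables (m1 : {sigma_finite_measure set X -> \bar R}).
Variables (m2 : {sigma_finite_measure set Y -> \bar R}).

(** Fubini's theorem. The integral of $|f|$ enters through Tonelli's theorem,
    to make $f$ integrable for the product measure; for the integrands below
    it is the same integral with the parameters replaced by their real
    parts. *)
Lemma has_cint_prod (f : X * Y -> C) (g h : X -> C) (v w : C) :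
  cmeasurable f ->
  (forall x, has_cint m2 (fun y => f (x, y)) (g x)) ->
  (forall x, has_cint m2 (fun y => `|f (x, y)|) (h x)) ->
  has_cint m1 h w -> has_cint m1 g v -> has_cint (m1 \x m2)%E f v.
Proof.
move=> [mf1 mf2] fg fh hw [_ _ gv1 gv2].
have intf (u : X * Y -> R) : measurable_fun setT u ->
    (forall p, `|u p| <= complex.Re `|f p|) ->
    (m1 \x m2)%E.-integrable setT (EFin \o u).
  move=> mu uf; apply/integrable12ltyP; first exact/measurable_EFinP.
  have [h1 _ hw1 _] := hw.
  have m_abs : measurable_fun setT (fun p => `|(u p)%:E|%E).
    by apply: measurableT_comp => //; apply/measurable_EFinP.
  apply: (@le_lt_trans _ _ (\int[m1]_x (complex.Re (h x))%:E)%E); last first.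
    by rewrite hw1 ltry.
  apply: ge0_le_integral => //.
  - by move=> x _; exact: integral_ge0.
  - exact: (measurable_fun_fubini_tonelli_F (fun p => `|(u p)%:E|%E)).
  - exact: measurable_int h1.
  - move=> x _; have [k1 _ e1 _] := fh x; rewrite -e1.
    apply: ge0_le_integral => //.
    + apply: measurableT_comp => //; apply/measurable_EFinP.
      exact: measurableT_comp.
    + exact: measurable_int k1.
    + by move=> y _; rewrite /= lee_fin.
have i1 : (m1 \x m2)%E.-integrable setT (fun p => (complex.Re (f p))%:E).
  apply: intf => // p; have := normc_ge_Re (f p).
  by rewrite normc_def lecR.
have i2 : (m1 \x m2)%E.-integrable setT (fun p => (complex.Im (f p))%:E).
  apply: intf => // p; have := normc_ge_Im (f p).
  by rewrite normc_def lecR.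
split => //.
- rewrite -integral12_prod_meas1// -gv1; apply: eq_integral => x _.
  by rewrite /fubini_F; have [_ _ -> _] := fg x.
- rewrite -integral12_prod_meas1// -gv2; apply: eq_integral => x _.
  by rewrite /fubini_F; have [_ _ _ ->] := fg x.
Qed.

(** The other order of integration. After the previous lemma, it gives both the
    convergence and the value of an iterated integral from those of another. *)
Lemma has_cint_swap (f : X * Y -> C) (g : Y -> C) (v : C) :
  has_cint (m1 \x m2)%E f v ->
  (forall y, has_cint m1 (fun x => f (x, y)) (g y)) -> has_cint m2 g v.
Proof.
move=> [i1 i2 e1 e2] fg.
have intG (u : X * Y -> \bar R) : (m1 \x m2)%E.-integrable setT u ->
    m2.-integrable setT (fubini_G m1 u).
  move=> iu; have mG := measurable_fubini_G iu.
  apply/integrableP; split => //.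
  have mu := measurable_int _ iu.
  apply: le_lt_trans ((integrable21ltyP m1 m2 mu).1 iu).
  apply: ge0_le_integral => //.
  - exact: measurableT_comp.
  - apply: (measurable_fun_fubini_tonelli_G (fun p => `|u p|%E)) => //=.
    exact: measurableT_comp.
  - move=> y _; apply: le_abse_integral => //; exact: measurableT_comp.
have g1 : fubini_G m1 (fun p => (complex.Re (f p))%:E) =
          (fun y => (complex.Re (g y))%:E).
  by apply/funext => y; rewrite /fubini_G; have [_ _ -> _] := fg y.
have g2 : fubini_G m1 (fun p => (complex.Im (f p))%:E) =
          (fun y => (complex.Im (g y))%:E).
  by apply/funext => y; rewrite /fubini_G; have [_ _ _ ->] := fg y.
split.
- by rewrite -g1; exact: intG.
- by rewrite -g2; exact: intG.
- by rewrite -g1 integral21_prod_meas1.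
- by rewrite -g2 integral21_prod_meas1.
Qed.

End fubini.

Section pushforward.
Context d1 d2 (X : measurableType d1) (Y : measurableType d2).

Lemma has_cint_pushforward (mu : {measure set X -> \bar R})
    (nu : {measure set Y -> \bar R}) (phi : X -> Y) (f : Y -> C) (v : C) :
  measurable_fun setT phi ->
  (forall A, measurable A -> nu A = mu (phi @^-1` A)) ->
  cmeasurable f ->
  has_cint mu (f \o phi) v -> has_cint nu f v.
Proof.
move=> mphi nuE [mf1 mf2] [i1 i2 e1 e2].
have ge0int (u : Y -> \bar R) : measurable_fun setT u -> (forall y, 0 <= u y)%E ->
    (\int[nu]_y u y = \int[mu]_x u (phi x))%E.
  move=> m_u u0; rewrite (eq_measure_integral (pushforward mu phi)).
    by rewrite ge0_integral_pushforward// preimage_setT.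
  by move=> A mA _; exact: nuE.
have int (u : Y -> \bar R) : measurable_fun setT u ->
    mu.-integrable setT (u \o phi) ->
    nu.-integrable setT u /\ (\int[nu]_y u y = \int[mu]_x u (phi x))%E.
  move=> m_u iu; split.
    apply/integrableP; split => //; rewrite ge0int//; last exact: measurableT_comp.
    by case/integrableP: iu.
  rewrite (eq_measure_integral (pushforward mu phi)); last first.
    by move=> A mA _; exact: nuE.
  by rewrite integral_pushforward// preimage_setT.
have [j1 k1] := int _ ((measurable_EFinP _ _).2 mf1) i1.
have [j2 k2] := int _ ((measurable_EFinP _ _).2 mf2) i2.
by split => //; [rewrite k1|rewrite k2].
Qed.

End pushforward.

Section lebesgue.
Local Notation leb := (@lebesgue_measure R).

(** The right-hand side is a measure in $A$ which agrees with Lebesgue measure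
    on intervals. *)
Lemma lebesgue_measure_affine (a b : R) (A : set (measurableTypeR R)) :
  0 < a -> measurable A ->
  (leb A = a%:E * leb ((fun x : R => (a * x + b)%R) @^-1` A))%E.
Proof.
move=> a0 mA.
have mphi : measurable_fun setT (fun x : measurableTypeR R => a * x + b).
  by apply: measurable_funD => //; exact: measurable_funM.
rewrite (@lebesgue_measure_unique _ (mscale (NngNum (ltW a0))
  (pushforward leb ((fun x => a * x + b) : measurableTypeR R -> measurableTypeR R))))// => _ [[x y]] _ <-.
transitivity (a%:E * leb [set` `](x - b) / a, (y - b) / a]%R])%E; last first.
  congr (_ * leb _)%E.
  by apply/seteqP; split => z /=; rewrite !in_itv/= ltr_pdivrMr// ler_pdivlMr//;
     rewrite ltrBlDr lerBrDr mulrC.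
rewrite !lebesgue_measure_itv/= !lte_fin ltr_pM2r ?invr_gt0// ltrD2r.
case: ifPn => _; last by rewrite mule0.
by rewrite -EFinD -EFinM; congr EFin; field; rewrite gt_eqF.
Qed.

Lemma has_cint_mscale (k : {nonneg R}) (f : R -> C) (v : C) :
  has_cint leb f v -> has_cint (mscale k leb) f (k%:num%:C * v).
Proof.
have ge0 (u : R -> \bar R) : measurable_fun setT u -> (forall x, 0 <= u x)%E ->
    (\int[mscale k leb]_x u x = k%:num%:E * \int[leb]_x u x)%E.
  by move=> mu u0; rewrite ge0_integral_mscale.
have int (u : R -> \bar R) : leb.-integrable setT u ->
    (mscale k leb).-integrable setT u /\
    (\int[mscale k leb]_x u x = k%:num%:E * \int[leb]_x u x)%E.
  move=> iu; have mu := measurable_int _ iu; split.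
    apply/integrableP; split => //; rewrite ge0//; last exact: measurableT_comp.
    have [_ iuoo] := integrableP _ _ _ iu.
    by rewrite lte_mul_pinfty// lee_fin.
  have iupos : (\int[leb]_x u^\+ x)%E \is a fin_num.
    by apply: integrable_fin_num => //; exact: integrable_funepos.
  have mup : measurable_fun setT u^\+%E by exact: measurable_funepos.
  have mun : measurable_fun setT u^\-%E by exact: measurable_funeneg.
  rewrite [LHS]integralE (ge0 _ mup)// (ge0 _ mun)// -muleBr//; last first.
    exact: fin_num_adde_defr.
  by congr (_ * _)%E; rewrite [RHS]integralE.
move=> [/int[j1 k1] /int[j2 k2] e1 e2]; split => //.
- by rewrite k1 e1 -EFinM Re_mul/= mul0r subr0.
- by rewrite k2 e2 -EFinM Im_mul/= mul0r addr0.
Qed.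

Lemma has_cint_affine (a b : R) (f : R -> C) (v : C) : 0 < a ->
  has_cint leb f v -> has_cint leb (fun x => f (a * x + b)) (a^-1%:C * v).
Proof.
move=> a0 fv.
have mphi : measurable_fun setT (fun x : measurableTypeR R => a * x + b).
  by apply: measurable_funD => //; exact: measurable_funM.
have mpsi : measurable_fun setT (fun x : measurableTypeR R => a^-1 * x + - (b / a)).
  by apply: measurable_funD => //; exact: measurable_funM.
have ai0 : 0 < a^-1 by rewrite invr_gt0.
refine (@has_cint_pushforward _ _ (measurableTypeR R) (measurableTypeR R)
  (mscale (NngNum (ltW ai0)) leb) leb
  (fun x : measurableTypeR R => a^-1 * x + - (b / a)) _ _ mpsi _ _ _).
- by move=> A mA; exact: (lebesgue_measure_affine (- (b / a)) ai0 mA).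
- exact: cmeasurable_comp mphi (has_cint_cmeasurable fv).
have -> : (fun x => f (a * x + b)) \o (fun x => a^-1 * x + - (b / a)) = f.
  by apply/funext => x /=; congr f; field; rewrite gt_eqF.
exact: has_cint_mscale.
Qed.

End lebesgue.
End complex_integral.

Section has_integral_more.
Context {R : realType}.
Local Notation C := R[i].

Section order.
Context d (T : measurableType d) (mu : {measure set T -> \bar R}).

Lemma has_cint_le (f g : T -> C) v w : has_cint mu f v -> has_cint mu g w ->
  (forall t, complex.Re (f t) <= complex.Re (g t)) ->
  complex.Re v <= complex.Re w.
Proof.
move=> [f1 _ v1 _] [g1 _ w1 _] fg; rewrite -lee_fin -v1 -w1.
by apply: le_integral => // t _; rewrite lee_fin.
Qed.

Lemma has_cint_restrict (D : set T) (f g : T -> C) (v : C) : measurable D ->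
  (forall t, D t -> g t = f t) -> (forall t, ~ D t -> g t = 0) ->
  has_cint mu g v -> cintegrable mu D f /\ cintegral mu D f = v.
Proof.
move=> mD gf g0 [i1 i2 e1 e2].
have pE (p : C -> R) : p 0 = 0 ->
    (fun t => (p (g t))%:E) = ((fun t => (p (f t))%:E) \_ D).
  move=> p0; apply/funext => t; rewrite patchE; case: ifPn => [/set_mem Dt|].
    by rewrite gf.
  by rewrite notin_setE => Dt; rewrite g0// p0.
have [r1 r2] := (pE (@complex.Re R) erefl, pE (@complex.Im R) erefl).
split; first by split; apply/integrable_mkcond; rewrite // -?r1 -?r2.
by apply/eqP; rewrite eq_complex /= /Rintegral !(integral_mkcond D) -r1 -r2 e1 e2 /= !eqxx.
Qed.

Lemma cintegral_has_cint (D : set T) (f g : T -> C) (v : C) : measurable D ->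
  (forall t, D t -> g t = f t) -> (forall t, ~ D t -> g t = 0) ->
  has_cint mu g v -> has_cint mu g (cintegral mu D f).
Proof. by move=> mD gf g0 gv; have [_ ->] := has_cint_restrict mD gf g0 gv. Qed.

End order.

Local Notation leb := (@lebesgue_measure R).

Lemma has_cint_gt0 (f : R -> C) v (a b e : R) : has_cint leb f v ->
  a < b -> 0 < e -> (forall x, 0 <= complex.Re (f x)) ->
  (forall x, a < x <= b -> e <= complex.Re (f x)) -> 0 < complex.Re v.
Proof.
move=> [f1 _ v1 _] ab e0 f0 fe.
have ltev : (0 < e%:E * (b - a)%:E)%E by rewrite -EFinM lte_fin mulr_gt0// subr_gt0.
rewrite -lte_fin -v1; apply: lt_le_trans ltev _.
have -> : (e%:E * (b - a)%:E =
    \int[leb]_x (((cst e%:E : R -> \bar R) \_ `]a, b]) x))%E.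
  by rewrite -integral_mkcond integral_cst//= lebesgue_measure_itv/= lte_fin ab.
apply: ge0_le_integral => //.
- by move=> x _; rewrite patchE; case: ifP => _ //=; rewrite lee_fin ltW.
- by apply/(measurable_restrictT _ _).1.
- exact: measurable_int f1.
- move=> x _; rewrite patchE; case: ifPn => [/set_mem|_]; last by rewrite lee_fin.
  by rewrite /= in_itv/= => /fe; rewrite lee_fin.
Qed.

(** The factor $x_+^0$ is the indicator function of the open half-line. *)
Lemma has_cint_halfline (u : R -> R) (r : R) : measurable_fun setT u ->
  (forall x, 0 <= x -> 0 <= u x) ->
  (\int[leb]_(x in `[0%R, +oo[) (u x)%:E = r%:E)%E ->
  has_cint leb (fun x => ppow x 0 * (u x)%:C) r%:C.
Proof.
move=> mu u0 ur.
have uE : (fun x => ppow x 0 * (u x)%:C) = (fun x => ((u \_ `]0, +oo[) x)%:C).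
  apply/funext => x; rewrite patchE /ppow; case: ifPn => x0.
    by rewrite cpow_x0 mul1r mem_set//= in_itv/= andbT.
  by rewrite mul0r memNset//= in_itv/= andbT; exact/negP.
have mu0 : measurable_fun setT (u \_ `]0, +oo[).
  by apply/(measurable_restrictT _ _).1 => //; exact: measurable_funTS.
have int : (\int[leb]_x ((u \_ `]0, +oo[) x)%:E = r%:E)%E.
  rewrite -ur -integral_itv_obnd_cbnd; last by apply/measurable_EFinP/measurable_funTS.
  by rewrite [RHS]integral_mkcond; apply: eq_integral => x _; rewrite restrict_EFin.
rewrite uE; apply: has_cint_real => //; apply/integrableP; split.
  exact/measurable_EFinP.
rewrite (_ : \int[_]_x _ = r%:E)%E ?ltry// -int; apply: eq_integral => x _ /=.
rewrite ger0_norm// patchE; case: ifPn => // /set_mem; rewrite /= in_itv/= andbT.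
by move=> /ltW; exact: u0.
Qed.

End has_integral_more.

(** * Integrals over spaces of tuples *)

Section tuple_integral.
Context {R : realType}.
Local Notation C := R[i].
Local Notation leb := (@lebesgue_measure R).

Definition cat_pair N m (p : N.-tuple (measurableTypeR R) * m.-tuple (measurableTypeR R)) :
  (N + m).-tuple (measurableTypeR R) := [tuple of p.1 ++ p.2].

(** Integrands are functions of finite sequences, which removes the casts
    between tuple types of equal lengths. *)
Definition tmeasurable N (f : seq R -> C) : Prop :=
  cmeasurable (fun t : N.-tuple (measurableTypeR R) => f t).

Definition tcint N (f : seq R -> C) (v : C) : Prop :=
  has_cint (lebesgue_tuple R N) (fun t => f t) v.

Lemma measurable_nth d (T : measurableType d) N
    (h : T -> N.-tuple (measurableTypeR R)) k :
  measurable_fun setT h -> measurable_fun setT (fun t => nth (0 : R) (h t) k).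
Proof.
move=> mh; have [kN|Nk] := ltnP k N.
  apply: eq_measurable_fun (measurableT_comp (measurable_tnth (Ordinal kN)) mh).
  by move=> t _ /=; rewrite (tnth_nth 0).
rewrite (_ : (fun t => _) = fun=> (0 : R)); first exact: measurable_cst.
by apply/funext => t; rewrite nth_default// size_tuple.
Qed.

Lemma measurable_cat_pair N m : measurable_fun setT (@cat_pair N m).
Proof.
apply/measurable_fun_tnthP => i.
rewrite (_ : _ \o _ = (fun p : N.-tuple _ * m.-tuple _ =>
  if (i < N)%N then nth 0 p.1 i else nth 0 p.2 (i - N))); last first.
  by apply/funext => p /=; rewrite (tnth_nth 0)/= nth_cat size_tuple.
by case: (i < N)%N; exact: measurable_nth.
Qed.

Lemma measurable_cat N m (t : N.-tuple (measurableTypeR R)) :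
  measurable_fun setT (fun s => @cat_pair N m (t, s)).
Proof.
apply: (measurableT_comp (@measurable_cat_pair N m)).
exact: measurable_fun_pair.
Qed.

Local Open Scope ereal_scope.

Lemma ge0_integral_rcons K (g : seq R -> \bar R) :
  (forall s, 0 <= g s) ->
  measurable_fun setT (fun t : K.+1.-tuple (measurableTypeR R) => g t) ->
  \int[lebesgue_tuple R K.+1]_t g t =
  \int[lebesgue_tuple R K]_t \int[leb]_x g (rcons t x).
Proof.
move=> g0 mg; have mrcons := @measurable_rcons_pair R K.
rewrite (eq_measure_integral
  (pushforward (lebesgue_tuple R K \x leb) (@rcons_pair R K)))//.
rewrite ge0_integral_pushforward// preimage_setT fubini_tonelli1//.
  exact: measurableT_comp.
by move=> x; exact: g0.
Qed.

(** Tonelli's theorem for concatenated tuples, one coordinate at a time. *)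
Lemma ge0_integral_cat N m (g : seq R -> \bar R) :
  (forall s, 0 <= g s) ->
  measurable_fun setT (fun t : (N + m).-tuple (measurableTypeR R) => g t) ->
  \int[lebesgue_tuple R (N + m)]_t g t =
  \int[lebesgue_tuple R N]_t \int[lebesgue_tuple R m]_s g (t ++ s).
Proof.
elim: m g => [|m IH] g g0.
  move=> mg; rewrite [in LHS]addn0; apply: eq_integral => t _.
  have mgt := measurableT_comp mg (@measurable_cat N 0 t).
  rewrite (eq_measure_integral (dirac ([tuple] : 0.-tuple (measurableTypeR R))))//.
  by rewrite integral_dirac// diracT mul1e cats0.
rewrite addnS => mg; rewrite ge0_integral_rcons//.
rewrite (IH (fun s => \int[leb]_x g (rcons s x))); last 2 first.
- by move=> s; exact: integral_ge0.
- apply: (measurable_fun_fubini_tonelli_F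
    (fun p : (N + m).-tuple (measurableTypeR R) * _ => g (rcons p.1 p.2))) => //.
  exact: (measurableT_comp mg (@measurable_rcons_pair R _)).
apply: eq_integral => t _; rewrite (@ge0_integral_rcons _ (fun s => g (t ++ s)))//.
  by apply: eq_integral => s _; apply: eq_integral => x _; rewrite rcons_cat.
have := @measurable_cat N m.+1 t; move: mg; rewrite -addnS => mg mcat.
exact: (measurableT_comp mg mcat).
Qed.

(** Both sides are the integral of the indicator function of $A$, by the
    preceding lemma. *)
Lemma lebesgue_tuple_cat N m (A : set ((N + m).-tuple (measurableTypeR R))) :
  measurable A ->
  lebesgue_tuple R (N + m) A =
  (lebesgue_tuple R N \x lebesgue_tuple R m) (@cat_pair N m @^-1` A).
Proof.
move=> mA; pose g (s : seq R) : \bar R := (\1_[set tval t | t in A] s)%:E.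
have gE (t : (N + m).-tuple (measurableTypeR R)) : g t = (\1_A t)%:E.
  rewrite /g !indicE; have [At|At] := pselect (A t).
    by rewrite !mem_set//; exists t.
  by rewrite !memNset// => -[u Au /val_inj ut]; apply: At; rewrite -ut.
have -> : lebesgue_tuple R (N + m) A = \int[lebesgue_tuple R (N + m)]_t (\1_A t)%:E.
  by rewrite integral_indic// setIT.
have -> : \int[lebesgue_tuple R (N + m)]_t (\1_A t)%:E =
          \int[lebesgue_tuple R (N + m)]_t g t.
  by apply: eq_integral => t _; rewrite gE.
rewrite ge0_integral_cat//; last 2 first.
- by move=> s; rewrite lee_fin.
- by under eq_fun do rewrite gE; exact/measurable_EFinP.
rewrite /product_measure1; apply: eq_integral => t _ /=.
have mAt : measurable (xsection (@cat_pair N m @^-1` A) t).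
  apply: measurable_xsection; rewrite -[X in measurable X]setTI.
  exact: measurable_cat_pair.
transitivity (\int[lebesgue_tuple R m]_s (\1_(xsection (@cat_pair N m @^-1` A) t) s)%:E);
  last by rewrite integral_indic// setIT.
apply: eq_integral => s _.
rewrite -[t ++ s]/(tval (@cat_pair N m (t, s))) gE !indicE; congr ((nat_of_bool _)%:R%:E).
by apply/idP/idP; rewrite !inE /xsection /= inE.
Qed.

Local Close Scope ereal_scope.

(** Fubini's theorem for concatenated tuples. *)
Lemma tcint_cat N m (f g h : seq R -> C) (v w : C) :
  tmeasurable (N + m) f ->
  (forall t, size t = N -> tcint m (fun s => f (t ++ s)) (g t)) ->
  (forall t, size t = N -> tcint m (fun s => `|f (t ++ s)|) (h t)) ->
  tcint N h w -> tcint N g v -> tcint (N + m) f v.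
Proof.
move=> mf fg fh hw gv.
apply: (has_cint_pushforward (mu := (lebesgue_tuple R N \x lebesgue_tuple R m)%E)
  (@measurable_cat_pair N m) (@lebesgue_tuple_cat N m)) => //.
apply: has_cint_prod hw gv; first exact: cmeasurable_comp (@measurable_cat_pair N m) mf.
  by move=> t; apply: fg; rewrite size_tuple.
by move=> t; apply: fh; rewrite size_tuple.
Qed.

Lemma tcint_rcons N (f g h : seq R -> C) (v w : C) :
  tmeasurable N.+1 f ->
  (forall t, size t = N -> has_cint leb (fun x => f (rcons t x)) (g t)) ->
  (forall t, size t = N -> has_cint leb (fun x => `|f (rcons t x)|) (h t)) ->
  tcint N h w -> tcint N g v -> tcint N.+1 f v.
Proof.
move=> mf fg fh hw gv.
apply: (has_cint_pushforward (mu := (lebesgue_tuple R N \x leb)%E)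
  (@measurable_rcons_pair R N)) => //.
apply: has_cint_prod hw gv; first exact: cmeasurable_comp (@measurable_rcons_pair R N) mf.
  by move=> t; apply: fg; rewrite size_tuple.
by move=> t; apply: fh; rewrite size_tuple.
Qed.

Lemma tcint0 (f : seq R -> C) : tcint 0 f (f [::]).
Proof.
have mf (u : 0.-tuple (measurableTypeR R) -> R) : measurable_fun setT u.
  rewrite (_ : u = fun=> u [tuple]); first exact: measurable_cst.
  by apply/funext => t; rewrite tuple0.
have int (u : 0.-tuple (measurableTypeR R) -> R) :
    (lebesgue_tuple R 0).-integrable setT (EFin \o u) /\
    (\int[lebesgue_tuple R 0]_t (u t)%:E = (u [tuple])%:E)%E.
  have diracE (k : 0.-tuple (measurableTypeR R) -> \bar R) : measurable_fun setT k ->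
     (\int[lebesgue_tuple R 0]_t k t = k [tuple])%E.
    move=> mk; rewrite (eq_measure_integral (dirac ([tuple] : 0.-tuple (measurableTypeR R))))//.
    by rewrite integral_dirac// diracT mul1e.
  have mu : measurable_fun setT (EFin \o u) by exact/measurable_EFinP.
  split; last exact: (diracE _ mu).
  apply/integrableP; split => //.
  by rewrite diracE /= ?ltry//; exact: measurableT_comp.
have [i1 e1] := int (fun t => complex.Re (f t)).
have [i2 e2] := int (fun t => complex.Im (f t)).
by split.
Qed.

End tuple_integral.

(** * Euler's integral *)

Section trigonometric_bounds.
Context {R : realType}.
Implicit Types x : R.

Lemma sqr_sin_le x : sin x ^+ 2 <= x ^+ 2.
Proof.
wlog x0 : x / 0 <= x.
  move=> H; have [/H//|x0] := leP 0 x.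
  by have := H (- x); rewrite sinN !sqrrN; apply; rewrite oppr_ge0 ltW.
have [c _] := MVT_segment x0 (fun z _ => is_derive_sin z)
  (continuous_subspaceT (@continuous_sin R)).
by rewrite sin0 !subr0 => ->; rewrite exprMn -[leRHS]mul1r ler_wpM2r ?sqr_ge0//.
Qed.

Lemma cos_ge_parabola x : 1 - x ^+ 2 / 2 <= cos x.
Proof.
have -> : cos x = 1 - 2 * sin (x / 2) ^+ 2.
  have {1}-> : x = (x / 2) *+ 2 by rewrite -mulr_natr; field.
  by rewrite cos_mulr2n cos2sin2; ring.
by have := sqr_sin_le (x / 2); nra.
Qed.

Lemma sqr_ln_le (r : R) : 0 < r -> ln r ^+ 2 <= 4 * (r + r^-1 - 2).
Proof.
move=> r0.
(* with $h = \ln(r)/2$ this is $|h| \le |e^h - e^{-h}|$, which follows from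
   the tangent bounds on $e^h$ and $e^{-h}$ *)
pose h := ln r / 2; pose s := expR h; pose s' := expR (- h).
have ss : s * s' = 1 by rewrite /s /s' -expRD subrr expR0.
have lnr : ln r = h + h by rewrite /h; field.
have rE : r = s * s by rewrite /s -expRD -lnr lnK.
have rVE : r^-1 = s' * s'.
  by rewrite rE invfM /s /s' expRN.
rewrite rVE {2}rE lnr.
have s0 : 0 < s by exact: expR_gt0.
have s'0 : 0 < s' by exact: expR_gt0.
have hs : 1 + h <= s by exact: expR_ge1Dx.
have hs' : 1 - h <= s' by exact: expR_ge1Dx.
by have [h0|h0] := leP 0 h; nra.
Qed.

End trigonometric_bounds.

Section gamma.
Context {R : realType}.
Local Notation C := R[i].
Local Notation leb := (@lebesgue_measure R).
Implicit Types (z : C) (p t : R).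

Lemma has_cint_expRN t : 0 < t ->
  has_cint leb (fun x => ppow x 0 * (expR (- (t * x)))%:C) t^-1%:C.
Proof.
move=> t0.
have : has_cint leb (fun x => ppow x 0 * (t * expR (- t * x))%:C) 1%:C.
  apply: has_cint_halfline.
  - apply: measurable_funM => //; apply: measurableT_comp => //.
  - by move=> x _; rewrite mulr_ge0 ?expR_ge0 ?ltW.
  - rewrite -(integral_exponential_pdf t0) integral_mkcond.
    by apply: eq_integral => x _; rewrite restrict_EFin.
move=> /(has_cintZ t^-1%:C); rewrite mulr1; apply: has_cint_eq => x.
rewrite mulrCA -rmorphM/= mulrA mulVf ?gt_eqF// mul1r mulNr.
by [].
Qed.

Let dln p (v : R) : -1 < v ->
  is_derive v 1 (fun v => expR (p * ln (1 + v))) (p * expR ((p - 1) * ln (1 + v))).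
Proof.
move=> v1; have v0 : 0 < 1 + v by rewrite -ltrBlDl sub0r.
have d1 : is_derive v 1 (fun v : R => 1 + v) 1.
  by have := is_deriveD (is_derive_cst (1 : R) v 1) (is_derive_id v 1); rewrite add0r.
have d2 := @is_derive1_ln R _ v0.
have d3 : is_derive v 1 (fun v : R => ln (1 + v)) ((1 + v)^-1).
  by have := is_derive1_comp d2 d1; rewrite mulr1.
have d4 : is_derive v 1 (fun v : R => p * ln (1 + v)) (p * (1 + v)^-1).
  exact: is_deriveZ.
have := is_derive1_comp (is_derive_expR _) d4.
rewrite mulrBl mul1r expRB lnK ?posrE// => d5; apply: is_derive_eq.
by rewrite mulrCA.
Qed.

(** The antiderivative is $-(1+v)^{-p}/p$. *)
Lemma has_cint_powRNS p : 0 < p ->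
  has_cint leb (fun v => ppow v 0 * ppow (1 + v) (- (p + 1))%:C) p^-1%:C.
Proof.
move=> p0.
pose f (v : R) := expR ((- p - 1) * ln (1 + v)).
pose F (v : R) := - p^-1 * expR (- p * ln (1 + v)).
have dF (v : R) : -1 < v -> is_derive v 1 F (f v).
  move=> v1; have d := @dln (- p) v v1.
  have := is_deriveZ (- p^-1) d; rewrite /f /F => dd.
  apply: is_derive_eq; rewrite /GRing.scale/= mulrA mulrNN mulVf ?gt_eqF//.
  by rewrite mul1r.
have cF (v : R) : -1 < v -> {for v, continuous F}.
  move=> v1; apply: differentiable_continuous; apply/derivable1_diffP.
  by have [] := dF v v1.
have cf (v : R) : -1 < v -> {for v, continuous f}.
  move=> v1; apply: differentiable_continuous; apply/derivable1_diffP.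
  by have [] := @dln (- p - 1) v v1.
have Foo : F x @[x --> +oo] --> 0.
  rewrite -(mulr0 (- p^-1)); apply: cvgM; first exact: cvg_cst.
  apply/cvgrPdist_lt => e e0; near=> v.
  rewrite sub0r normrN ger0_norm ?expR_ge0// -[ltRHS]lnK// ltr_expR.
  rewrite mulNr ltrNl -ltr_pdivrMl//.
  have v0 : 0 < 1 + v by rewrite ltr_wpDl.
  rewrite -ltr_expR lnK ?posrE//.
  by apply: (@lt_trans _ _ v); rewrite ?ltrDr.
have int : (\int[leb]_(x in `[0%R, +oo[) (f x)%:E = p^-1%:E)%E.
  rewrite (@ge0_continuous_FTC2y _ f F 0 0).
  - by rewrite /F addr0 ln1 mulr0 expR0 mulr1 -EFinB sub0r opprK.
  - by move=> x _; exact: expR_ge0.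
  - apply/continuous_within_itvcyP; split.
      move=> x; rewrite in_itv/= andbT => x0; apply: cf.
      by rewrite (lt_trans _ x0)// ltrN10.
    by apply: cvg_at_right_filter; apply: cf; rewrite ltrN10.
  - exact: Foo.
  - move=> x x0; have [] // := dF x _.
    by rewrite (lt_trans _ x0)// ltrN10.
  - by apply: cvg_at_right_filter; apply: cF; rewrite ltrN10.
  - move=> x; rewrite in_itv/= andbT => x0; rewrite derive1E.
    have x1 : -1 < x by rewrite (lt_trans _ x0)// ltrN10.
    by have d := dF x x1; exact: derive_val.
apply: (has_cint_eq _ (has_cint_halfline _ _ int)).
- move=> x; rewrite /ppow; have [x0|x0] := ltP 0 x; last by rewrite !mul0r.
  rewrite ltr_pwDl ?ltW//; congr (_ * _).
  by rewrite /f /cpow -rmorphM cexp_real opprD.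
- rewrite /f; apply: measurableT_comp => //; apply: measurable_funM => //.
  by apply: measurableT_comp => //; exact: measurable_funD.
- by move=> x _; exact: expR_ge0.
Unshelve. all: by end_near. Qed.

Lemma has_cint_cpowNS z : 0 < complex.Re z ->
  exists l, has_cint leb (fun v => ppow v 0 * ppow (1 + v) (- (z + 1))) l.
Proof.
move=> z0; have [i1 _ _ _] := has_cint_powRNS z0.
apply: has_cint_dom i1.
  apply: cmeasurableM; apply: cmeasurable_ppow => //; exact: measurable_funD.
move=> v; rewrite normrM !norm_ppow Re_opp Re_add /=.
rewrite /ppow; case: ifP => v0; last by rewrite !mul0r.
by rewrite cpow_x0 !mul1r ltr_pwDl ?(ltW v0)// cpow_real ?ltr_pwDl ?(ltW v0).
Qed.

Definition gamma_ker z (x : R) : C := ppow x (z - 1) * (expR (- x))%:C.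

Lemma cmeasurable_gamma_ker z : cmeasurable (gamma_ker z).
Proof.
apply: cmeasurableM; first exact: cmeasurable_ppow.
by apply: cmeasurable_real; exact: measurableT_comp.
Qed.

(** Convergence of Euler's integral away from the singularity at $0$: with
    $q = \mathrm{Re}\,z - 1 > 0$, the integrand is at most
    $(2q)^q e^{-x/2}$ in absolute value. *)
Lemma has_cint_gamma_ker_gt1 z : 1 < complex.Re z ->
  exists v, has_cint leb (gamma_ker z) v.
Proof.
move=> z1; pose q := complex.Re z - 1; have q0 : 0 < q by rewrite subr_gt0.
have [i1 _ _ _] := has_cintZ (expR (q * ln (2 * q)))%:C (has_cint_expRN (t := 2^-1) ltac:(by rewrite invr_gt0)).
apply: has_cint_dom i1; first exact: cmeasurable_gamma_ker.
move=> x; rewrite /gamma_ker normrM norm_real norm_ppow ger0_norm ?expR_ge0//.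
rewrite /ppow; case: ifP => x0; last by rewrite !mul0r mulr0.
rewrite cpow_x0 mul1r -rmorphM/= /cpow -rmorphM cexp_real -rmorphM lecR.
rewrite -!expRD ler_expR Re_add Re_opp/=.
(* $\ln u \le u$ at $u = x/2q$ *)
have : ln (x / (2 * q)) <= x / (2 * q).
  have x2q : 0 < x / (2 * q) by rewrite divr_gt0// mulr_gt0.
  by have := expR_ge1Dx (ln (x / (2 * q))); rewrite lnK ?posrE//; lra.
rewrite lnM ?lnV ?posrE ?invr_gt0 ?mulr_gt0//.
rewrite -(ler_pM2l q0) => h.
have e : q * (x / (2 * q)) = x / 2 by field; rewrite gt_eqF.
by rewrite e mulrDr mulrN in h; rewrite -/q; lra.
Qed.

Lemma has_cint_gamma_ker_scale z c v : 0 < c -> has_cint leb (gamma_ker z) v ->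
  has_cint leb (fun x => ppow x (z - 1) * (expR (- (c * x)))%:C)
    (cpow c (- z) * v).
Proof.
move=> c0 /(has_cint_affine 0 c0) /(has_cintZ (cpow c (1 - z))) h.
have e : cpow c (1 - z) * c^-1%:C = cpow c (- z).
  by rewrite cpowD cpow1// mulrAC -rmorphM/= mulfV ?gt_eqF// mul1r.
rewrite mulrA e in h; apply: has_cint_eq h => x.
rewrite /gamma_ker addr0 ppowM// !mulrA -cpowD.
by rewrite (_ : 1 - z + (z - 1) = 0) ?cpow_x0 ?mul1r//; ring.
Qed.

Lemma cmeasurable_laplace d (T : measurableType d) (a : C) (c t : T -> R) :
  measurable_fun setT c -> measurable_fun setT t ->
  cmeasurable (fun y => ppow (t y) a * (expR (- (c y * t y)))%:C).
Proof.
move=> mc mt; apply: cmeasurableM; first exact: cmeasurable_ppow.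
apply: cmeasurable_real; apply: measurableT_comp => //.
by apply: measurable_funN; exact: measurable_funM.
Qed.

(** Both sides are the double integral of $t^z e^{-(1+v)t}$ over $t, v > 0$.
    As $l = 1/z$ for real $z$, this is the functional equation; it also shows
    that Euler's integral converges at $0$, since it is known to converge for
    $z + 1$. *)
Lemma has_cint_gamma_ker_rec z l w : 0 < complex.Re z ->
  has_cint leb (fun v => ppow v 0 * ppow (1 + v) (- (z + 1))) l ->
  has_cint leb (gamma_ker (z + 1)) w -> has_cint leb (gamma_ker z) (l * w).
Proof.
move=> z0 hl hw.
pose f (p : measurableTypeR R * measurableTypeR R) : C :=
  ppow p.1 0 * (ppow p.2 z * (expR (- ((1 + p.1) * p.2)))%:C).
pose r : C := (complex.Re z)%:C.
have [w' hw'] : exists w', has_cint leb (gamma_ker (r + 1)) w'.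
  by apply: has_cint_gamma_ker_gt1; rewrite Re_add /= ltrDr.
have [l' hl'] := @has_cint_cpowNS r z0.
have inner (a u : C) v : has_cint leb (gamma_ker (a + 1)) u ->
    has_cint leb (fun t => ppow v 0 * (ppow t a * (expR (- ((1 + v) * t)))%:C))
      (u * (ppow v 0 * ppow (1 + v) (- (a + 1)))).
  move=> hu; have [v0|v0] := ltP 0 v; last first.
    rewrite {2}ppow_le0// mul0r mulr0; apply: has_cint_eq (has_cint0 _) => t.
    by rewrite ppow_le0// mul0r.
  have v1 : 0 < 1 + v by rewrite ltr_pwDl ?ltW.
  have := has_cintZ (ppow v 0) (has_cint_gamma_ker_scale v1 hu).
  by rewrite addrK (ppowE _ v1) mulrA mulrC mulrA -mulrA.
have hf : has_cint (leb \x leb)%E f (w * l).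
  refine (@has_cint_prod R _ _ _ _ leb leb f
    (fun v => w * (ppow v 0 * ppow (1 + v) (- (z + 1))))
    (fun v => w' * (ppow v 0 * ppow (1 + v) (- (r + 1)))) _ (w' * l') _ _ _ _ _).
  - apply: cmeasurableM; first exact: cmeasurable_ppow.
    by apply: cmeasurable_laplace => //; exact: measurable_funD.
  - by move=> v; exact: inner.
  - move=> v; apply: has_cint_eq (inner r w' v hw') => t.
    by rewrite !normrM !norm_ppow norm_real ger0_norm ?expR_ge0.
  - exact: has_cintZ.
  - exact: has_cintZ.
rewrite mulrC; apply: (has_cint_swap hf) => t; rewrite /f/=.
have [t0|t0] := ltP 0 t; last first.
  rewrite (_ : gamma_ker z t = 0); last by rewrite /gamma_ker ppow_le0// mul0r.
  apply: has_cint_eq (has_cint0 _) => v.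
  by rewrite (ppow_le0 _ t0) mul0r mulr0.
have := has_cintZ (ppow t z * (expR (- t))%:C) (has_cint_expRN t0).
have -> : ppow t z * (expR (- t))%:C * t^-1%:C = gamma_ker z t.
  rewrite /gamma_ker !ppowE// cpowD cpowN cpow1// mulrAC.
  by rewrite -fmorphV.
apply: has_cint_eq => v.
rewrite mulrDl mul1r opprD expRD rmorphM /=; rewrite (mulrC v t); ring.
Qed.

Lemma cGamma_has_cint z : 0 < complex.Re z -> has_cint leb (gamma_ker z) (cGamma z).
Proof.
move=> z0; have [l hl] := has_cint_cpowNS z0.
have [w hw] : exists w, has_cint leb (gamma_ker (z + 1)) w.
  by apply: has_cint_gamma_ker_gt1; rewrite Re_add /= ltrDr.
apply: cintegral_has_cint (has_cint_gamma_ker_rec z0 hl hw) => //.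
- by move=> x; rewrite /gamma_ker /= in_itv/= andbT => x0; rewrite ppowE.
- by move=> x; rewrite /gamma_ker /= in_itv/= andbT => /negP; rewrite -leNgt => x0; rewrite ppow_le0// mul0r.
Qed.

Lemma cGamma_rec z l : 0 < complex.Re z ->
  has_cint leb (fun v => ppow v 0 * ppow (1 + v) (- (z + 1))) l ->
  cGamma z = l * cGamma (z + 1).
Proof.
move=> z0 hl; apply: has_cint_unique (cGamma_has_cint z0) _.
apply: has_cint_gamma_ker_rec => //; apply: cGamma_has_cint.
by rewrite Re_add /= addr_gt0.
Qed.

Lemma cGamma_realS p : 0 < p -> cGamma (p%:C + 1) = p%:C * cGamma (p%:C : C).
Proof.
move=> p0; rewrite (@cGamma_rec p%:C p^-1%:C) ?mulrA//.
  by rewrite -rmorphM mulfV ?gt_eqF// mul1r.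
apply: has_cint_eq (has_cint_powRNS p0) => v.
by rewrite rmorphN rmorphD.
Qed.

Lemma cGamma_real_gt0 p : 0 < p -> 0 < complex.Re (cGamma (p%:C : C)).
Proof.
move=> p0; have pE : p%:C - 1 = (p - 1)%:C :> C by rewrite rmorphB.
apply: (@has_cint_gt0 _ _ _ 1 2 (expR (- `|p - 1| * ln 2 - 2))
  (cGamma_has_cint _)) => //.
- by rewrite ltr1n.
- exact: expR_gt0.
- move=> x; rewrite /gamma_ker Re_mul /= mulr0 subr0 mulr_ge0 ?expR_ge0//.
  rewrite /ppow; case: ifP => x0 //.
  by rewrite pE cpow_real//= powR_ge0.
- move=> x /andP[x1 x2]; have x0 : 0 < x by rewrite (lt_trans _ x1).
  rewrite /gamma_ker ppowE// /cpow pE -rmorphM cexp_real -rmorphM.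
  rewrite -expRD ler_expR lerD//; last by rewrite lerN2.
  have lnx : 0 <= ln x <= ln 2.
    by apply/andP; split; [rewrite ln_ge0 ?ltW|rewrite ler_ln ?posrE].
  have := ler_norm (- (p - 1)); rewrite normrN => h.
  have := normr_ge0 (p - 1); nra.
Qed.

(** The integral $\int_1^\infty w^{-z-1}\,dw$ is multiplied by $r^{-z}$ when
    its lower limit is replaced by $r$; if it vanished, so would the integral
    over $[1, r]$, whose integrand has a positive real part for $r$ close
    to $1$. *)
Lemma has_cint_cpowNS_neq0 z l : 0 < complex.Re z ->
  has_cint leb (fun v => ppow v 0 * ppow (1 + v) (- (z + 1))) l -> l != 0.
Proof.
move=> z0 hl; apply/eqP => l0; rewrite l0 in hl.
have h1 : has_cint leb (fun w => ppow (w - 1) 0 * ppow w (- (z + 1))) 0.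
  have := has_cint_affine (-1) ltr01 hl; rewrite mulr0; apply: has_cint_eq => w.
  by rewrite mul1r addrCA subrr addr0.
pose d := (1 + `|complex.Im z|)^-1.
have d0 : 0 < d by rewrite invr_gt0 ltr_pwDl.
pose r := expR d; have r0 : 0 < r by exact: expR_gt0.
have r1 : 1 < r by rewrite /r expR_gt1.
have h2 : has_cint leb (fun w => ppow (w - r) 0 * ppow w (- (z + 1))) 0.
  have ri0 : 0 < r^-1 by rewrite invr_gt0.
  have := has_cintZ (cpow r^-1 (z + 1)) (has_cint_affine 0 ri0 h1).
  rewrite !mulr0; apply: has_cint_eq => w; rewrite addr0 mulrCA; congr (_ * _).
    rewrite (_ : r^-1 * w - 1 = r^-1 * (w - r)) ?ppowM ?cpow_x0 ?mul1r//.
    by field; rewrite gt_eqF.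
  by rewrite ppowM// mulrA -cpowD addrN cpow_x0 mul1r.
have := has_cintB h1 h2; rewrite subrr => h.
have difE w : ppow (w - 1) 0 * ppow w (- (z + 1)) -
    ppow (w - r) 0 * ppow w (- (z + 1)) =
    if 1 < w <= r then cpow w (- (z + 1)) else 0.
  rewrite -mulrBl /ppow !subr_gt0 !cpow_x0; case: ltP => w1 /=; last first.
    by rewrite ltNge (le_trans w1 (ltW r1))/= subrr mul0r.
  rewrite (lt_trans ltr01 w1); case: ltP => wr; first by rewrite subrr mul0r.
  by rewrite subr0 mul1r.
have Re_ge w : 1 < w <= r ->
    expR (- (complex.Re z + 1) * d) / 2 <= complex.Re (cpow w (- (z + 1))).
  move=> /andP[w1 wr]; have w0 : 0 < w by rewrite (lt_trans ltr01 w1).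
  have lnw : 0 <= ln w <= d.
    by apply/andP; split; [rewrite ln_ge0 ?ltW|rewrite -[d]expRK ler_ln ?posrE].
  rewrite /cpow /cexp /= Re_mul Im_mul /= !mulr0 subr0 add0r Re_opp Im_opp Re_add Im_add /= addr0.
  apply: ler_pM; rewrite ?expR_ge0 ?invr_ge0//.
    by rewrite ler_expR; nra.
  apply: le_trans (cos_ge_parabola _).
  have : (- complex.Im z * ln w) ^+ 2 <= 1.
    have dE : d * (1 + `|complex.Im z|) = 1 by rewrite mulVf// gt_eqF// ltr_pwDl.
    rewrite exprMn sqrrN -[complex.Im z ^+ 2]real_normK ?num_real// -exprMn.
    case/andP: lnw => l1 l2; have n0 := normr_ge0 (complex.Im z).
    rewrite exprn_ile1// ?mulr_ge0//.
    by have := ler_wpM2l n0 l2; move: d0 dE; lra.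
  by move: (_ ^+ 2) => q; lra.
have := @has_cint_gt0 _ _ _ 1 r (expR (- (complex.Re z + 1) * d) / 2) h r1.
rewrite /= ltxx divr_gt0 ?expR_gt0// => /(_ isT) H.
suff : false by [].
apply: H => x; rewrite difE; last by move=> xr; rewrite xr Re_ge.
case: ifP => // xr; apply: le_trans (Re_ge _ xr).
by rewrite divr_ge0 ?expR_ge0.
Qed.


End gamma.

(** * Zeros of the Gamma function *)

Section gamma_neq0.
Context {R : realType}.
Local Notation C := R[i].
Local Notation leb := (@lebesgue_measure R).
Implicit Types (z : C) (p t : R).

Let gamma_ker_real p t : 0 < t ->
  gamma_ker p%:C t = (expR ((p - 1) * ln t) * expR (- t))%:C.
Proof.
move=> t0; have pE : p%:C - 1 = (p - 1)%:C :> C by rewrite rmorphB.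
by rewrite /gamma_ker ppowE// /cpow pE -rmorphM cexp_real -rmorphM.
Qed.

(** For large $p$ the mass of $t^{p-1}e^{-t}$ concentrates near $t = p$, where
    the phase of $t^{iy}$ is nearly constant: the loss in
    $\cos(y\ln(t/p)) \ge 1 - y^2\ln^2(t/p)/2$ is controlled by the first
    moments of $t$ and $1/t$. *)
Lemma cGamma_neq0_large z :
  1 + 2 * complex.Im z ^+ 2 < complex.Re z -> cGamma z != 0.
Proof.
set p := complex.Re z; set y := complex.Im z => yp.
have y2 : 0 <= y ^+ 2 by exact: sqr_ge0.
have p1 : 1 < p by lra.
have p0 : 0 < p by lra.
pose G : C := cGamma (p - 1)%:C.
have GRe : 0 < complex.Re G by apply: cGamma_real_gt0; rewrite subr_gt0.
have Gp : cGamma p%:C = (p - 1)%:C * G :> C.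
  rewrite /G -cGamma_realS ?subr_gt0//; congr cGamma.
  by rewrite rmorphB/= subrK.
have GpS : cGamma (p + 1)%:C = (p * (p - 1))%:C * G :> C.
  by rewrite rmorphD/= cGamma_realS// Gp mulrA -rmorphM.
have h0 : has_cint leb (gamma_ker (p - 1)%:C) G.
  by apply: cGamma_has_cint; rewrite subr_gt0.
have h1 : has_cint leb (gamma_ker p%:C) ((p - 1)%:C * G).
  by rewrite -Gp; exact: cGamma_has_cint.
have h2 : has_cint leb (gamma_ker (p + 1)%:C) ((p * (p - 1))%:C * G).
  by rewrite -GpS; apply: cGamma_has_cint; rewrite addr_gt0.
have low := has_cintB h1 (has_cintB (has_cintB (has_cintZ (2 * y ^+ 2 / p)%:C h2)
  (has_cintZ (4 * y ^+ 2)%:C h1)) (has_cintZ (- (2 * y ^+ 2 * p))%:C h0)).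
have up := has_cintZ (cpow p (- (y%:C * 'i%C))) (@cGamma_has_cint R z p0).
have : 0 < complex.Re (cpow p (- (y%:C * 'i%C)) * cGamma z).
  apply: lt_le_trans (has_cint_le low up _).
    rewrite (_ : _ - _ = (p - 1 - 2 * y ^+ 2)%:C * G).
      rewrite Re_mul/= mul0r subr0 mulr_gt0// /p; lra.
    rewrite !mulrA -!rmorphM -!mulrBl -!rmorphB; congr (_%:C * _).
    by field; rewrite gt_eqF.
  move=> t; have [t0|t0] := ltP 0 t; last first.
    by rewrite /gamma_ker !ppow_le0// !mul0r !mulr0 !subr0.
  rewrite !gamma_ker_real// -!rmorphM -!rmorphB /=.
  rewrite (_ : cpow _ _ * gamma_ker z t = cexp (Complex ((p - 1) * ln t) (y * (ln t - ln p))) * (expR (- t))%:C); last first.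
    rewrite /gamma_ker ppowE// /cpow mulrA -cexpD; congr (cexp _ * _).
    apply/eqP; rewrite eq_complex !(Re_add, Im_add, Re_mul, Im_mul, Re_opp, Im_opp)/=.
    by apply/andP; split; apply/eqP; rewrite /p /y; ring.
  rewrite Re_mul/= mulr0 subr0.
  set e := expR (- t).
  have lnB : ln t - ln p = ln (t / p) by rewrite lnM ?lnV ?posrE ?invr_gt0.
  pose A := expR ((p - 1 - 1) * ln t).
  have tE : t = expR (ln t) by rewrite lnK.
  have A1 : expR ((p - 1) * ln t) = A * t.
    by rewrite [in RHS]tE /A -expRD; congr expR; ring.
  have A2 : expR ((p + 1 - 1) * ln t) = A * t * t.
    by rewrite -A1 [X in _ = _ * X]tE -expRD; congr expR; ring.
  rewrite A1 A2 -/A lnB.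
  have cosB := cos_ge_parabola (y * ln (t / p)).
  have lnL := @sqr_ln_le R (t / p) (divr_gt0 t0 p0).
  have A0 : 0 < A * e by rewrite mulr_gt0 ?expR_gt0.
  have key : 1 - 2 * y ^+ 2 * (t / p + p / t - 2) <= cos (y * ln (t / p)).
    apply: le_trans cosB; rewrite exprMn.
    have := ler_wpM2l y2 lnL; rewrite invf_div; lra.
  have := ler_wpM2l (ltW (mulr_gt0 A0 t0)) key; rewrite (_ : _ * (1 - _) =
    A * t * e - (2 * y ^+ 2 / p * (A * t * t * e) - 4 * y ^+ 2 * (A * t * e) -
     - (2 * y ^+ 2 * p) * (A * e))); last by field; rewrite !gt_eqF.
  by move/le_trans; apply; rewrite le_eqVlt; apply/orP; left; apply/eqP; ring.
by apply: contraTneq => ->; rewrite mulr0 ltxx.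
Qed.

(** The recursion, whose factor does not vanish, reduces the claim to points
    with a large real part and the same imaginary part. *)
Lemma cGamma_neq0 z : 0 < complex.Re z -> cGamma z != 0.
Proof.
move=> z0.
suff H n w : 0 < complex.Re w -> complex.Im w = complex.Im z ->
    1 + 2 * complex.Im z ^+ 2 < complex.Re w + n%:R -> cGamma w != 0.
  apply: (H (Num.trunc (1 + 2 * complex.Im z ^+ 2)).+1 z) => //.
  apply: (@lt_trans _ _ (Num.trunc (1 + 2 * complex.Im z ^+ 2)).+1%:R).
    by rewrite truncnS_gt.
  by rewrite ltrDr.
elim: n w => [|n IH] w w0 wz hw.
  by apply: cGamma_neq0_large; rewrite wz -[ltRHS]addr0.
have [l hl] := has_cint_cpowNS w0.
rewrite (cGamma_rec w0 hl) mulf_neq0//; first exact: has_cint_cpowNS_neq0 hl.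
apply: IH; rewrite ?Re_add ?Im_add/= ?addr0// ?addr_gt0//.
by move: hw; rewrite -natr1; lra.
Qed.

End gamma_neq0.

(** * Beta and quadratic integrals on the line *)

Section beta.
Context {R : realType}.
Local Notation C := R[i].
Local Notation leb := (@lebesgue_measure R).
Local Notation half := ((2^-1 : R)%:C : C).
Implicit Types (z s : C) (c r t u : R).

(** $\Gamma(\sigma)(c+u)^{-\sigma}$ is the Laplace transform of
    $t^{\sigma-1}e^{-ct}$ at $u$; integrating against $u^{\alpha-1}$ first
    leaves an Euler integral in $t$. *)
Lemma has_cint_beta (al si : C) c : 0 < c ->
  0 < complex.Re al -> 0 < complex.Re (si - al) ->
  has_cint leb (fun u => ppow u (al - 1) * ppow (c + u) (- si))
    (cpow c (al - si) * (cGamma al * cGamma (si - al) / cGamma si)).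
Proof.
move=> c0 al0 sa0.
have si0 : 0 < complex.Re si by rewrite -[si](subrK al) Re_add addr_gt0.
pose f (a s : C) (p : measurableTypeR R * measurableTypeR R) : C :=
  (ppow p.1 (s - 1) * (expR (- (c * p.1)))%:C) *
  (ppow p.2 (a - 1) * (expR (- (p.1 * p.2)))%:C).
have inner (a s : C) t : 0 < complex.Re a ->
    has_cint leb (fun u => f a s (t, u))
      (cGamma a * (ppow t (s - a - 1) * (expR (- (c * t)))%:C)).
  move=> a0; rewrite /f/=; have [t0|t0] := ltP 0 t; last first.
    rewrite !(ppow_le0 _ t0) !mul0r mulr0.
    by apply: has_cint_eq (has_cint0 _) => u; rewrite !mul0r.
  have := has_cintZ (ppow t (s - 1) * (expR (- (c * t)))%:C)
    (has_cint_gamma_ker_scale t0 (cGamma_has_cint a0)).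
  congr has_cint; rewrite !ppowE// (_ : s - a - 1 = s - 1 + - a) ?cpowD; ring.
have outer (a s : C) : 0 < complex.Re (s - a) ->
    has_cint leb (fun t => cGamma a * (ppow t (s - a - 1) * (expR (- (c * t)))%:C))
      (cGamma a * (cpow c (- (s - a)) * cGamma (s - a))).
  move=> sa; apply: has_cintZ; apply: has_cint_gamma_ker_scale => //.
  exact: cGamma_has_cint.
pose ra : C := (complex.Re al)%:C; pose rs : C := (complex.Re si)%:C.
have hf : has_cint (leb \x leb)%E (f al si)
    (cGamma al * (cpow c (- (si - al)) * cGamma (si - al))).
  refine (@has_cint_prod R _ _ _ _ leb leb (f al si) _
    (fun t => cGamma ra * (ppow t (rs - ra - 1) * (expR (- (c * t)))%:C)) _
    (cGamma ra * (cpow c (- (rs - ra)) * cGamma (rs - ra))) _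
    (fun t => inner al si t al0) _ _ (outer _ _ sa0)).
  - by apply: cmeasurableM; apply: cmeasurable_laplace.
  - move=> t; apply: has_cint_eq (inner ra rs t al0) => u.
    by rewrite /f !normrM !norm_ppow !norm_real !ger0_norm ?expR_ge0// !Re_sub !rmorphB.
  - by apply: outer; move: sa0; rewrite !Re_sub.
have hg u : has_cint leb (fun t => f al si (t, u))
    (cGamma si * (ppow u (al - 1) * ppow (c + u) (- si))).
  rewrite /f/=; have [u0|u0] := ltP 0 u; last first.
    rewrite (ppow_le0 _ u0) mul0r mulr0; apply: has_cint_eq (has_cint0 _) => t.
    by rewrite mul0r mulr0.
  have cu0 : 0 < c + u by rewrite addr_gt0.
  have := has_cintZ (ppow u (al - 1))
    (has_cint_gamma_ker_scale cu0 (cGamma_has_cint si0)).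
  rewrite (ppowE _ cu0) mulrA mulrC; apply: has_cint_eq => t.
  by rewrite mulrDl opprD expRD rmorphM /= (mulrC u t); ring.
have := has_cintZ (cGamma si)^-1 (has_cint_swap hf hg).
rewrite (_ : (cGamma si)^-1 * _ = cpow c (al - si) * (cGamma al * cGamma (si - al) / cGamma si)).
  by apply: has_cint_eq => u; rewrite mulKf// cGamma_neq0.
by rewrite opprB; ring.
Qed.

Lemma has_cint_gauss (a d : R) : 0 < a ->
  has_cint leb (fun x => (expR (- (a * (x + d) ^+ 2)))%:C)
    (cpow pi half * cpow a (- half)).
Proof.
move=> a0; pose q := Num.sqrt a; have q0 : 0 < q by rewrite sqrtr_gt0.
have qq : q ^+ 2 = a by rewrite sqr_sqrtr ?ltW.
have h : has_cint leb (fun x => (gauss_fun x)%:C) (Num.sqrt pi)%:C.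
  by apply: has_cint_real; [exact: integrableT_gauss|exact: integralT_gauss].
have := has_cint_affine (q * d) q0 h.
have -> : q^-1%:C * (Num.sqrt pi)%:C = cpow pi half * cpow a (- half).
  rewrite -rmorphN !cpow_real ?pi_gt0// powRN powR12_sqrt ?pi_ge0//.
  by rewrite powR12_sqrt ?ltW// mulrC.
apply: has_cint_eq => x; rewrite /gauss_fun -mulrDr exprMn qq.
by [].
Qed.

(** Here $\Gamma(s)(c+w)^{-s}$, with $w = r(x+d)^2$, is the integral of
    $t^{s-1}e^{-ct}e^{-tw}$ in $t$; integrating over $x$ first is a Gaussian
    integral and lowers the exponent of $t$ by $1/2$. *)
Lemma has_cint_quadratic s c r d : 0 < c -> 0 < r -> 2^-1 < complex.Re s ->
  has_cint leb (fun x => ppow (c + r * (x + d) ^+ 2) (- s))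
    (cpow r (- half) * (cpow pi half * (cGamma (s - half) / cGamma s)) *
     cpow c (- (s - half))).
Proof.
move=> c0 r0 s12.
have s0 : 0 < complex.Re s by rewrite (lt_trans _ s12)// invr_gt0.
have sh0 (z : C) : 2^-1 < complex.Re z -> 0 < complex.Re (z - half).
  by rewrite Re_sub subr_gt0.
pose f (z : C) (p : measurableTypeR R * measurableTypeR R) : C :=
  (ppow p.1 (z - 1) * (expR (- (c * p.1)))%:C) *
  (expR (- (p.1 * r * (p.2 + d) ^+ 2)))%:C.
have inner (z : C) t : has_cint leb (fun x => f z (t, x))
    (cpow pi half * cpow r (- half) * (ppow t (z - half - 1) * (expR (- (c * t)))%:C)).
  rewrite /f/=; have [t0|t0] := ltP 0 t; last first.
    rewrite !(ppow_le0 _ t0) !mul0r mulr0.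
    by apply: has_cint_eq (has_cint0 _) => u; rewrite !mul0r.
  have := has_cintZ (ppow t (z - 1) * (expR (- (c * t)))%:C)
    (has_cint_gauss d (mulr_gt0 t0 r0)).
  congr has_cint; rewrite cpowM// !ppowE// (_ : z - half - 1 = z - 1 + - half) ?cpowD; ring.
have outer (z : C) : 2^-1 < complex.Re z ->
    has_cint leb (fun t => cpow pi half * cpow r (- half) *
       (ppow t (z - half - 1) * (expR (- (c * t)))%:C))
      (cpow pi half * cpow r (- half) *
        (cpow c (- (z - half)) * cGamma (z - half))).
  move=> z12; apply: has_cintZ; apply: has_cint_gamma_ker_scale => //.
  by apply: cGamma_has_cint; exact: sh0.
pose rs : C := (complex.Re s)%:C.
have hf : has_cint (leb \x leb)%E (f s)
    (cpow pi half * cpow r (- half) * (cpow c (- (s - half)) * cGamma (s - half))).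
  refine (@has_cint_prod R _ _ _ _ leb leb (f s) _
    (fun t => cpow pi half * cpow r (- half) *
       (ppow t (rs - half - 1) * (expR (- (c * t)))%:C)) _
    (cpow pi half * cpow r (- half) *
        (cpow c (- (rs - half)) * cGamma (rs - half))) _
    (inner s) _ (outer _ _) (outer _ s12)) => //.
  - apply: cmeasurableM; first exact: cmeasurable_laplace.
    apply: cmeasurable_real; apply: measurableT_comp => //; apply: measurable_funN.
    apply: measurable_funM; first exact: measurable_funM.
    by apply: measurable_funX; exact: measurable_funD.
  - move=> t; apply: has_cint_eq (inner rs t) => u.
    by rewrite /f !normrM !norm_ppow !norm_real !ger0_norm ?expR_ge0// !Re_sub !rmorphB.
have hg x : has_cint leb (fun t => f s (t, x))
    (cGamma s * ppow (c + r * (x + d) ^+ 2) (- s)).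
  have cu0 : 0 < c + r * (x + d) ^+ 2.
    by rewrite ltr_wpDr// mulr_ge0 ?sqr_ge0 ?ltW.
  have := has_cint_gamma_ker_scale cu0 (cGamma_has_cint s0).
  rewrite (ppowE _ cu0) [cGamma s * _]mulrC; apply: has_cint_eq => t; rewrite /f/=.
  rewrite mulrDl opprD expRD rmorphM /= mulrA; congr (_ * (expR (- _))%:C); ring.
have := has_cintZ (cGamma s)^-1 (has_cint_swap hf hg).
rewrite (_ : (cGamma s)^-1 * _ = cpow r (- half) * (cpow pi half * (cGamma (s - half) / cGamma s)) *
     cpow c (- (s - half))).
  by apply: has_cint_eq => u; rewrite mulKf// cGamma_neq0.
by ring.
Qed.

End beta.

(** * Positive definite matrices *)

Section positive_definite.
Context {R : realType}.

Definition qform n (A : 'M[R]_n) (v : 'rV[R]_n) : R := (v *m A *m v^T) 0 0.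

Lemma posdef_gt0 n (A : 'M[R]_n) v : posdef_matrix A -> v != 0 -> 0 < qform A v.
Proof. by case=> _; apply. Qed.

Lemma posdef_ge0 n (A : 'M[R]_n) v : posdef_matrix A -> 0 <= qform A v.
Proof.
move=> Apos; have [->|v0] := eqVneq v 0; last exact/ltW/posdef_gt0.
by rewrite /qform !mul0mx mxE.
Qed.

Lemma qformD n (A B : 'M[R]_n) v : qform (A + B) v = qform A v + qform B v.
Proof. by rewrite /qform mulmxDr mulmxDl mxE. Qed.

Lemma qformN n (A : 'M[R]_n) v : qform (- A) v = - qform A v.
Proof. by rewrite /qform mulmxN mulNmx mxE. Qed.

Lemma posdef1 n : posdef_matrix (1%:M : 'M[R]_n).
Proof.
split=> [|v v0]; first exact: trmx1.
rewrite mulmx1 mxE; under eq_bigr do rewrite mxE.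
have [i vi] : exists i, v 0 i != 0 by apply/rV0Pn.
rewrite (bigD1 i)//= ltr_pwDl//; first by rewrite -expr2 exprn_even_gt0.
by apply: sumr_ge0 => j _; rewrite -expr2 sqr_ge0.
Qed.

Lemma posdefD n (A B : 'M[R]_n) :
  posdef_matrix A -> posdef_matrix B -> posdef_matrix (A + B).
Proof.
move=> [At Ap] [Bt Bp]; split; first by rewrite linearD/= At Bt.
move=> v v0; have := qformD A B v; rewrite /qform => ->.
by rewrite addr_gt0 ?Ap ?Bp.
Qed.

Lemma mx11D (A B : 'M[R]_1) : (A + B) 0 0 = A 0 0 + B 0 0.
Proof. by rewrite mxE. Qed.

Lemma mx11Z (c : R) (A : 'M[R]_1) : (c *: A) 0 0 = c * A 0 0.
Proof. by rewrite mxE. Qed.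

Section bordered.
Variable m : nat.
Implicit Types (A : 'M[R]_m) (b v : 'rV[R]_m) (x y : R).

Definition bordered A b x : 'M[R]_(m + 1) := block_mx A b^T b x%:M.

Lemma bordered_eq (T : 'M[R]_(m + 1)) : T^T = T ->
  T = bordered (ulsubmx T) (dlsubmx T) (drsubmx T 0 0) /\ (ulsubmx T)^T = ulsubmx T.
Proof.
move=> Tt; split; last by rewrite trmx_ulsub Tt.
rewrite /bordered -[LHS]submxK trmx_dlsub Tt; congr block_mx.
by rewrite [LHS]mx11_scalar.
Qed.

Lemma tr_bordered A b x : A^T = A -> (bordered A b x)^T = bordered A b x.
Proof. by move=> At; rewrite /bordered tr_block_mx At trmxK tr_scalar_mx. Qed.

Lemma qform_bordered A b x v y : A^T = A ->
  qform (bordered A b x) (row_mx v y%:M) =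
  qform A v + (y * (b *m v^T) 0 0 *+ 2) + x * y ^+ 2.
Proof.
move=> At; rewrite /qform /bordered mul_row_block tr_row_mx mul_row_col tr_scalar_mx.
rewrite !mulmxDl !mul_scalar_mx -!scalemxAl !mul_mx_scalar scale_scalar_mx.
have e : (v *m b^T) 0 0 = (b *m v^T) 0 0.
  by rewrite -[v *m b^T]trmxK trmx_mul trmxK mxE.
rewrite !mx11D !mx11Z e !mxE/=; ring.
Qed.

(** Completing the square with respect to the leading block. *)
Lemma qform_bordered_ul A b x v y : A^T = A -> A \in unitmx ->
  qform (bordered A b x) (row_mx v y%:M) =
  qform A (v + y *: (b *m invmx A)) + (x - qform (invmx A) b) * y ^+ 2.
Proof.
move=> At Au; rewrite qform_bordered//.
set w := b *m invmx A; have wA : w *m A = b by rewrite /w mulmxKV.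
have Aw : A *m w^T = b^T by rewrite -{1}At -trmx_mul wA.
have e1 : v *m A *m w^T = v *m b^T by rewrite -mulmxA Aw.
have e2 : qform (invmx A) b = (b *m w^T) 0 0 by rewrite /qform -/w -Aw mulmxA wA.
have e3 : (v *m b^T) 0 0 = (b *m v^T) 0 0.
  by rewrite -[v *m b^T]trmxK trmx_mul trmxK mxE.
rewrite e2 {2}/qform [in RHS]mulmxDl -[in RHS]scalemxAl wA linearD/= linearZ/=.
rewrite mulmxDl !mulmxDr -!scalemxAr -!scalemxAl e1 !mx11D !mx11Z e3 -/(qform A v).
ring.
Qed.

(** Completing the square with respect to the last variable. *)
Lemma qform_bordered_dr A b x v y : A^T = A -> x != 0 ->
  qform (bordered A b x) (row_mx v y%:M) =
  qform (A - x^-1 *: (b^T *m b)) v + x * (y + x^-1 * (b *m v^T) 0 0) ^+ 2.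
Proof.
move=> At x0; rewrite qform_bordered// qformD qformN.
have -> : qform (x^-1 *: (b^T *m b)) v = x^-1 * (b *m v^T) 0 0 ^+ 2.
  rewrite /qform -scalemxAr -scalemxAl mxE; congr (_ * _).
  rewrite (mulmxA v) -(mulmxA (v *m b^T)).
  rewrite (_ : v *m b^T = (b *m v^T)^T); last by rewrite trmx_mul trmxK.
  by move: (b *m v^T) => c; rewrite mxE big_ord1 mxE expr2.
by field.
Qed.

Lemma det_bordered A b x : A \in unitmx ->
  \det (bordered A b x) = \det A * (x - qform (invmx A) b).
Proof.
move=> Au.
have -> : bordered A b x = block_mx 1%:M 0 (b *m invmx A) 1%:M *m
    block_mx A b^T 0 (x - qform (invmx A) b)%:M.
  rewrite mulmx_block !mul1mx !mul0mx !addr0 mulmxKV//.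
  congr block_mx; rewrite [X in X + _]mx11_scalar -raddfD/=; congr (_%:M).
  by rewrite /qform addrC subrK.
by rewrite det_mulmx det_lblock det_ublock !det1 !mul1r det_scalar1.
Qed.

Lemma det_bordered_dr A b x : x != 0 ->
  \det (bordered A b x) = x * \det (A - x^-1 *: (b^T *m b)).
Proof.
move=> x0.
have -> : bordered A b x = block_mx 1%:M (x^-1 *: b^T) 0 1%:M *m
    block_mx (A - x^-1 *: (b^T *m b)) 0 b x%:M.
  rewrite mulmx_block !mul1mx !mul0mx !add0r -scalemxAl subrK.
  by rewrite mul_mx_scalar scalerA mulfV// scale1r.
by rewrite det_mulmx det_lblock det_ublock !det1 !mul1r det_scalar1 mulrC.
Qed.

Lemma row_mx_neq0l v y : v != 0 -> row_mx v y%:M != 0.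
Proof. by apply: contra_neq => h; rewrite -(row_mxKl v y%:M) h linear0. Qed.

Lemma row_mx_neq0r v y : y != 0 -> row_mx v y%:M != 0.
Proof.
apply: contra_neq => /(congr1 rsubmx); rewrite row_mxKr linear0.
by move=> /matrixP/(_ 0 0); rewrite !mxE.
Qed.

Lemma posdef_bordered_ul A b x : A^T = A ->
  posdef_matrix (bordered A b x) -> posdef_matrix A.
Proof.
move=> At [_ Bp]; split=> // v v0; have := Bp _ (row_mx_neq0l 0 v0).
rewrite -/(qform _ _) qform_bordered// mul0r mul0rn expr0n/= mulr0 !addr0.
by [].
Qed.

Lemma posdef_bordered_dr A b x : A^T = A -> posdef_matrix (bordered A b x) ->
  0 < x /\ posdef_matrix (A - x^-1 *: (b^T *m b)).
Proof.
move=> At Bp.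
have x0 : 0 < x.
  have := posdef_gt0 Bp (@row_mx_neq0r 0 1 (oner_neq0 _)).
  by rewrite qform_bordered// /qform !mul0mx trmx0 mulmx0 !mxE mulr0 mul0rn expr1n mulr1 !add0r.
split=> //; split.
  by rewrite linearB/= linearZ/= trmx_mul trmxK At.
move=> v v0; have := posdef_gt0 Bp (@row_mx_neq0l v (- (x^-1 * (b *m v^T) 0 0)) v0).
by rewrite qform_bordered_dr ?gt_eqF// addNr expr0n/= mulr0 addr0.
Qed.

End bordered.

Lemma posdef_det_gt0 n (A : 'M[R]_n) : posdef_matrix A -> 0 < \det A.
Proof.
elim: n A => [|n IH]; first by move=> A _; rewrite det_mx00.
rewrite -addn1 => T Tpos; have [TE At] := bordered_eq Tpos.1.
rewrite TE in Tpos *; have Apos := posdef_bordered_ul At Tpos.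
have detA := IH _ Apos.
have Au : ulsubmx T \in unitmx by rewrite unitmxE unitfE gt_eqF.
rewrite det_bordered// mulr_gt0//.
set b := dlsubmx T in Tpos *; set A := ulsubmx T in At Apos Au Tpos *.
have := posdef_gt0 Tpos (@row_mx_neq0r _ (- (b *m invmx A)) 1 (oner_neq0 _)).
rewrite qform_bordered_ul// scale1r addNr expr1n mulr1 {1}/qform !mul0mx.
by rewrite mxE add0r.
Qed.

Lemma posdef_unitmx n (A : 'M[R]_n) : posdef_matrix A -> A \in unitmx.
Proof. by move=> /posdef_det_gt0 A0; rewrite unitmxE unitfE gt_eqF. Qed.

Lemma posdef_borderedP m (A : 'M[R]_m) b x : A^T = A ->
  posdef_matrix (bordered A b x) <->
  posdef_matrix A /\ 0 < \det (bordered A b x).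
Proof.
move=> At; split=> [Bp|[Ap B0]].
  by split; [exact: posdef_bordered_ul Bp|exact: posdef_det_gt0].
split; first exact: tr_bordered.
have Au := posdef_unitmx Ap.
have s0 : 0 < x - qform (invmx A) b.
  by move: B0; rewrite det_bordered// pmulr_rgt0// posdef_det_gt0.
move=> w; rewrite -(hsubmxK w) [rsubmx w]mx11_scalar.
set v := lsubmx w; set y := rsubmx w 0 0 => w0; rewrite -/(qform _ _).
rewrite qform_bordered_ul//; have [y0|y0] := eqVneq y 0.
  rewrite y0 scale0r addr0 expr0n/= mulr0 addr0; apply: posdef_gt0 => //.
  by apply: contra_neq w0 => ->; rewrite y0 raddf0 row_mx0.
by rewrite ltr_wpDl ?posdef_ge0// mulr_gt0// exprn_even_gt0.
Qed.

Lemma posdef_inv n (A : 'M[R]_n) : posdef_matrix A -> posdef_matrix (invmx A).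
Proof.
move=> Ap; have Au := posdef_unitmx Ap; split; first by rewrite trmx_inv Ap.1.
move=> v v0.
have w0 : v *m invmx A != 0.
  by apply: contra_neq v0 => h; rewrite -(mulmxKV Au v) h mul0mx.
have := posdef_gt0 Ap w0.
by rewrite /qform mulmxKV// trmx_mul trmx_inv Ap.1 mulmxA.
Qed.

(** $A^{-1} - (1+A)^{-1}$ is the inverse of $A + A^2$. *)
Lemma posdef_resolvent n (A : 'M[R]_n) : posdef_matrix A ->
  posdef_matrix (invmx A - invmx (1%:M + A)) /\
  \det (invmx A - invmx (1%:M + A)) = (\det A * \det (1%:M + A))^-1.
Proof.
move=> Ap; have Au := posdef_unitmx Ap.
have Bp : posdef_matrix (1%:M + A) by apply: posdefD => //; exact: posdef1.
have Bu := posdef_unitmx Bp.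
pose S := A *m (1%:M + A).
have AAp : posdef_matrix S.
  rewrite /S mulmxDr mulmx1; apply: posdefD => //; split.
    by rewrite trmx_mul Ap.1.
  move=> v v0; rewrite mulmxA -[v *m A *m A *m _]mulmxA -[X in _ *m (X *m _)]Ap.1 -trmx_mul.
  have w0 : v *m A != 0.
    by apply: contra_neq v0 => h; rewrite -(mulmxK Au v) h mul0mx.
  by have := posdef_gt0 (posdef1 n) w0; rewrite /qform mulmx1.
have Su := posdef_unitmx AAp.
have E : invmx A - invmx (1%:M + A) = invmx S.
  apply: (can_inj (mulKmx Su)); rewrite mulmxV// /S mulmxBr.
  rewrite -[X in _ - X]mulmxA mulmxV// mulmx1 -mulmxA mulmxDl mul1mx mulmxV//.
  by rewrite mulmxDr mulmxV// mulmx1 addrK.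
by rewrite E; split; [exact: posdef_inv|rewrite det_inv /S det_mulmx].
Qed.

End positive_definite.

(** * Powers of a quadratic form *)

Section quadratic_integral.
Context {R : realType}.
Local Notation C := R[i].
Local Notation leb := (@lebesgue_measure R).
Local Notation half := ((2^-1 : R)%:C : C).

Lemma tcint_cast M N (f : seq R -> C) v : N = M -> tcint M f v -> tcint N f v.
Proof. by move=> ->. Qed.

Definition seq_row m (s : seq R) : 'rV[R]_m := \row_i nth 0 s i.

Lemma seq_row_rcons m (s : seq R) x : size s = m ->
  seq_row (m + 1) (rcons s x) = row_mx (seq_row m s) x%:M.
Proof.
move=> sm; apply/rowP => i; rewrite mxE; case: (split_ordP i) => j ->.
  by rewrite row_mxEl mxE nth_rcons sm /= ltn_ord.
by rewrite row_mxEr mxE (ord1 j) nth_rcons sm /= addn0 ltnn eqxx.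
Qed.

Lemma measurable_qform N m (A : 'M[R]_m) :
  measurable_fun setT (fun t : N.-tuple (measurableTypeR R) => qform A (seq_row m t)).
Proof.
rewrite /qform; under eq_fun do rewrite mxE.
apply: measurable_sum => j; apply: measurable_funM.
  under eq_fun do rewrite mxE.
  apply: measurable_sum => i; apply: measurable_funM => //.
  by under eq_fun do rewrite mxE; exact: measurable_nth.
by under eq_fun do rewrite !mxE; exact: measurable_nth.
Qed.

(** Integrating over the last variable replaces $Q$ by its Schur complement
    and $s$ by $s - 1/2$. *)
Lemma tcint_qform m (Q : 'M[R]_m) (s : C) :
  posdef_matrix Q -> m%:R / 2 < complex.Re s ->
  tcint m (fun v => ppow (1 + qform Q (seq_row m v)) (- s))
    (cpow (\det Q) (- half) *
     (cpow pi (m%:R * half) * (cGamma (s - m%:R * half) / cGamma s))).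
Proof.
elim: m Q s => [|m IH].
  move=> Q s _; rewrite mul0r => s0.
  have := tcint0 (fun v => ppow (1 + qform Q (seq_row 0 v)) (- s)).
  rewrite det_mx00 /qform mxE big_ord0 addr0 ppowE// !cpow1l.
  by rewrite mul0r cpow_x0 subr0 divff ?cGamma_neq0// !mul1r.
rewrite -addn1 => T s Tpos ms.
have [TE At] := bordered_eq Tpos.1; rewrite TE in Tpos *.
move: (ulsubmx T) (dlsubmx T) (drsubmx T 0 0) At Tpos => A b x At Tpos {TE}.
have [x0 Qpos] := posdef_bordered_dr At Tpos.
rewrite det_bordered_dr ?gt_eqF//.
set Q := A - _ in Qpos *; have detQ := posdef_det_gt0 Qpos.
have ms' : m%:R / 2 < complex.Re s - 2^-1 by move: ms; rewrite natrD; lra.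
have s12 : 2^-1 < complex.Re s.
  by have := ler0n R m; move: ms'; lra.
have c0 (t : seq R) : 0 < 1 + qform Q (seq_row m t).
  by rewrite ltr_pwDl// posdef_ge0.
have inner (z : C) t : 2^-1 < complex.Re z -> size t = m ->
    has_cint leb (fun y => ppow (1 + qform (bordered A b x) (seq_row (m + 1) (rcons t y))) (- z))
      (cpow x (- half) * (cpow pi half * (cGamma (z - half) / cGamma z)) *
       ppow (1 + qform Q (seq_row m t)) (- (z - half))).
  move=> z12 tm; have := has_cint_quadratic (x^-1 * (b *m (seq_row m t)^T) 0 0) (c0 t) x0 z12.
  rewrite -(ppowE _ (c0 t)); apply: has_cint_eq => y.
  by rewrite seq_row_rcons// qform_bordered_dr ?gt_eqF// addrA.
pose r : C := (complex.Re s)%:C.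
have outer (z : C) : m%:R / 2 < complex.Re z - 2^-1 ->
    tcint m (fun t => cpow x (- half) * (cpow pi half * (cGamma (z - half) / cGamma z)) *
       ppow (1 + qform Q (seq_row m t)) (- (z - half)))
     (cpow x (- half) * (cpow pi half * (cGamma (z - half) / cGamma z)) *
       (cpow (\det Q) (- half) * (cpow pi (m%:R * half) *
         (cGamma (z - half - m%:R * half) / cGamma (z - half))))).
  by move=> zm; apply: has_cintZ; apply: IH => //; rewrite Re_sub.
have mQ := @measurable_qform (m + 1) _ (bordered A b x).
have hs := outer s ms'; have hr := outer r ms'.
have sh0 : cGamma (s - half) != 0 by apply: cGamma_neq0; rewrite Re_sub subr_gt0.
have s0 : cGamma s != 0.
  by apply: cGamma_neq0; rewrite (lt_trans _ s12)// invr_gt0.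
rewrite (_ : cpow (x * \det Q) _ * _ =
  cpow x (- half) * (cpow pi half * (cGamma (s - half) / cGamma s)) *
    (cpow (\det Q) (- half) * (cpow pi (m%:R * half) *
      (cGamma (s - half - m%:R * half) / cGamma (s - half))))); last first.
  rewrite cpowM// natrD mulrDl mul1r cpowD opprD addrA (addrAC s).
  by field; rewrite sh0 s0.
apply: (tcint_cast (addn1 m)); refine (tcint_rcons _ _ _ hr hs).
- by rewrite /tmeasurable -addn1; apply: cmeasurable_ppow; exact: measurable_funD.
- by move=> t tm; exact: inner.
- move=> t tm; apply: has_cint_eq (inner r t _ tm) => // y.
  by rewrite norm_ppow Re_opp rmorphN.
Qed.


End quadratic_integral.

(** * The last column *)

Section last_column.
Context {R : realType}.
Local Notation C := R[i].
Local Notation leb := (@lebesgue_measure R).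
Local Notation half := ((2^-1 : R)%:C : C).

(** What the column of index $m$ contributes to the integral, as a function of
    the exponents of its two pivots. *)
Definition column_factor (m : nat) (al be : C) : C :=
  cpow pi (m%:R * half) *
  (cGamma (al + 1) * cGamma (- be - al - 1 - m%:R * half) / cGamma (- be)).

Lemma seq_row_rcons_take m (s : seq R) x : size s = m ->
  seq_row m (rcons s x) = seq_row m s.
Proof. by move=> sm; apply/rowP => i; rewrite !mxE nth_rcons sm ltn_ord. Qed.

(** The last column is $(v, x)$ with $v$ of length $m$. Let $q$ be the form
    $A^{-1} - (1+A)^{-1}$. After the translation $x = y + vA^{-1}v^T$ the two
    pivots are $y$ and $1 + q(v) + y$, so the integral in $y$ is a Beta
    integral and leaves a power of $1 + q(v)$, to be integrated in $v$. The
    Gamma factor $\Gamma(-\beta-\alpha-1)$ produced by the first step cancels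
    in the second. *)
Lemma tcint_last_column m (A : 'M[R]_m) (al be : C) : posdef_matrix A ->
  0 < complex.Re (al + 1) -> m%:R / 2 < complex.Re (- be - al - 1) ->
  tcint m.+1 (fun u =>
      ppow (nth 0 u m - qform (invmx A) (seq_row m u)) al *
      ppow (1 + nth 0 u m - qform (invmx (1%:M + A)) (seq_row m u)) be)
    (column_factor m al be * (cpow (\det A) half * cpow (\det (1%:M + A)) half)).
Proof.
move=> Apos al0 be0.
have [Qpos detQ] := posdef_resolvent Apos.
have dA := posdef_det_gt0 Apos.
have dB : 0 < \det (1%:M + A) by apply/posdef_det_gt0/posdefD => //; exact: posdef1.
set Q := _ - _ in Qpos detQ.
have c0 (v : seq R) : 0 < 1 + qform Q (seq_row m v) by rewrite ltr_pwDl// posdef_ge0.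
have inner (a b : C) v : 0 < complex.Re (a + 1) -> m%:R / 2 < complex.Re (- b - a - 1) ->
    size v = m -> has_cint leb (fun x =>
      ppow (nth 0 (rcons v x) m - qform (invmx A) (seq_row m (rcons v x))) a *
      ppow (1 + nth 0 (rcons v x) m - qform (invmx (1%:M + A)) (seq_row m (rcons v x))) b)
    (cGamma (a + 1) * cGamma (- b - a - 1) / cGamma (- b) *
     ppow (1 + qform Q (seq_row m v)) (- (- b - a - 1))).
  move=> a0 b0 vm.
  have b0' : 0 < complex.Re (- b - (a + 1)).
    by rewrite opprD addrA; apply: le_lt_trans b0; rewrite divr_ge0.
  have := has_cint_affine (- qform (invmx A) (seq_row m v)) ltr01
    (has_cint_beta (c0 v) a0 b0').
  rewrite invr1 mul1r opprD addrA (ppowE _ (c0 v)) mulrC.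
  rewrite (_ : a + 1 - - b = - (- b - a - 1)); last by ring.
  apply: has_cint_eq => x.
  rewrite seq_row_rcons_take// nth_rcons vm ltnn eqxx mul1r addrK opprK.
  congr (_ * ppow _ _); rewrite qformD qformN; ring.
have outer (a b : C) : m%:R / 2 < complex.Re (- b - a - 1) ->
    tcint m (fun v => cGamma (a + 1) * cGamma (- b - a - 1) / cGamma (- b) *
      ppow (1 + qform Q (seq_row m v)) (- (- b - a - 1)))
    (cGamma (a + 1) * cGamma (- b - a - 1) / cGamma (- b) *
     (cpow (\det Q) (- half) * (cpow pi (m%:R * half) *
       (cGamma (- b - a - 1 - m%:R * half) / cGamma (- b - a - 1))))).
  by move=> b0; apply: has_cintZ; exact: tcint_qform.
pose ra : C := (complex.Re al)%:C; pose rb : C := (complex.Re be)%:C.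
have ra0 : 0 < complex.Re (ra + 1) by move: al0; rewrite !Re_add.
have rb0 : m%:R / 2 < complex.Re (- rb - ra - 1).
  by move: be0; rewrite !Re_sub !Re_opp.
rewrite (_ : column_factor _ _ _ * _ =
  cGamma (al + 1) * cGamma (- be - al - 1) / cGamma (- be) *
     (cpow (\det Q) (- half) * (cpow pi (m%:R * half) *
       (cGamma (- be - al - 1 - m%:R * half) / cGamma (- be - al - 1))))).
  refine (tcint_rcons _ _ _ (outer ra rb rb0) (outer al be be0)).
  - apply: cmeasurableM; apply: cmeasurable_ppow; apply: measurable_funB;
      try exact: measurable_qform.
      exact: measurable_nth.
    by apply: measurable_funD => //; exact: measurable_nth.
  - by move=> v vm; exact: inner.
  - move=> v vm; apply: has_cint_eq (inner ra rb v _ _ vm) => // x.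
    by rewrite normrM !norm_ppow.
rewrite /column_factor detQ cpowVl ?mulr_gt0// opprK cpowM//.
have g1 : cGamma (- be - al - 1) != 0.
  by apply: cGamma_neq0; apply: le_lt_trans be0; rewrite divr_ge0.
have g2 : cGamma (- be) != 0.
  apply: cGamma_neq0; have := ler0n R m.
  by move: be0 al0; rewrite !(Re_sub, Re_add)/=; lra.
by field; rewrite g1 g2.
Qed.

End last_column.

(** * Leading minors and pivots *)

Section symmetric_matrices.
Context {R : realType}.
Local Notation C := R[i].
Local Notation half := ((2^-1 : R)%:C : C).

(** One sequence of entries describes all leading blocks at once. *)
Definition symseq k (s : seq R) : 'M[R]_k :=
  \matrix_(i, j) nth 0 s (sym_index (minn i j) (maxn i j)).

Definition minor k (s : seq R) : R := \det (symseq k s).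
Definition minor1 k (s : seq R) : R := \det (1%:M + symseq k s).

Lemma tr_symseq k s : (symseq k s)^T = symseq k s.
Proof. by apply/matrixP => i j; rewrite !mxE minnC maxnC. Qed.

Definition last_row k (s : seq R) : 'rV[R]_k := \row_i nth 0 s (sym_index i k).

Lemma symseq_bordered k s :
  symseq (k + 1) s = bordered (symseq k s) (last_row k s) (nth 0 s (sym_index k k)).
Proof.
rewrite /bordered; apply/matrixP => i j.
case: (split_ordP i) => i' ->; case: (split_ordP j) => j' ->.
- by rewrite block_mxEul !mxE.
- rewrite block_mxEur !mxE /= (ord1 j') addn0.
  by rewrite (minn_idPl _) ?(maxn_idPr _)// ltnW.
- rewrite block_mxEdl !mxE /= (ord1 i') addn0.
  by rewrite (minn_idPr _) ?(maxn_idPl _)// ltnW.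
- by rewrite block_mxEdr !mxE /= (ord1 i') (ord1 j') addn0 minnn maxnn eqxx.
Qed.

Lemma symseq1_bordered k s : 1%:M + symseq (k + 1) s =
  bordered (1%:M + symseq k s) (last_row k s) (1 + nth 0 s (sym_index k k)).
Proof.
rewrite symseq_bordered /bordered (scalar_mx_block k 1 1) add_block_mx !add0r.
by rewrite -raddfD.
Qed.

Lemma posdef_symseqS k s : posdef_matrix (symseq k.+1 s) <->
  posdef_matrix (symseq k s) /\ 0 < minor k.+1 s.
Proof.
rewrite /minor -addn1 symseq_bordered; exact/posdef_borderedP/tr_symseq.
Qed.

Lemma posdef_symseq_le j k s : (j <= k)%N ->
  posdef_matrix (symseq k s) -> posdef_matrix (symseq j s).
Proof.
elim: k => [|k IH]; first by rewrite leqn0 => /eqP ->.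
by rewrite leq_eqVlt => /predU1P[->//|/IH jk] /posdef_symseqS[/jk].
Qed.

Lemma minor_gt0 k s : posdef_matrix (symseq k s) -> 0 < minor k s.
Proof. exact: posdef_det_gt0. Qed.

Lemma minor1_gt0 k s : posdef_matrix (symseq k s) -> 0 < minor1 k s.
Proof. by move=> p; apply/posdef_det_gt0/posdefD => //; exact: posdef1. Qed.

Lemma minor0 s : minor 0 s = 1.
Proof. exact: det_mx00. Qed.

Lemma minor10 s : minor1 0 s = 1.
Proof. exact: det_mx00. Qed.

Lemma symseq_cat k s u : ('C(k.+1, 2) <= size s)%N -> symseq k (s ++ u) = symseq k s.
Proof.
move=> ks; apply/matrixP => i j; rewrite !mxE nth_cat ifT//.
by apply: leq_trans ks; apply: sym_index_lt; rewrite gtn_max !ltn_ord geq_min leq_max leqnn.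
Qed.

Lemma pivot_cat k s u : size s = 'C(k.+1, 2) -> posdef_matrix (symseq k s) ->
  minor k.+1 (s ++ u) / minor k (s ++ u) =
  nth 0 u k - qform (invmx (symseq k s)) (seq_row k u).
Proof.
move=> sk sp.
have nthE i : nth 0 (s ++ u) (sym_index i k) = nth 0 u i.
  by rewrite nth_cat /sym_index sk ltnNge leq_addr /= addKn.
have rowE : last_row k (s ++ u) = seq_row k u by apply/rowP => i; rewrite !mxE nthE.
rewrite /minor -[k.+1]addn1 symseq_bordered nthE rowE symseq_cat ?sk//.
by rewrite det_bordered ?posdef_unitmx// mulrAC mulfV ?mul1r// gt_eqF// posdef_det_gt0.
Qed.

Lemma pivot1_cat k s u : size s = 'C(k.+1, 2) -> posdef_matrix (symseq k s) ->
  minor1 k.+1 (s ++ u) / minor1 k (s ++ u) =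
  1 + nth 0 u k - qform (invmx (1%:M + symseq k s)) (seq_row k u).
Proof.
move=> sk sp.
have p1 : posdef_matrix (1%:M + symseq k s) by apply: posdefD => //; exact: posdef1.
have nthE i : nth 0 (s ++ u) (sym_index i k) = nth 0 u i.
  by rewrite nth_cat /sym_index sk ltnNge leq_addr /= addKn.
have rowE : last_row k (s ++ u) = seq_row k u by apply/rowP => i; rewrite !mxE nthE.
rewrite /minor1 -[k.+1]addn1 symseq1_bordered nthE rowE symseq_cat ?sk//.
by rewrite det_bordered ?posdef_unitmx// mulrAC mulfV ?mul1r// gt_eqF// posdef_det_gt0.
Qed.

Lemma measurable_det d (T : measurableType d) k (A : T -> 'M[R]_k) :
  (forall i j, measurable_fun setT (fun t => A t i j)) ->
  measurable_fun setT (fun t => \det (A t)).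
Proof.
move=> mA; rewrite /determinant; apply: measurable_sum => p.
apply: measurable_funM => //; apply: measurable_prod => i _; exact: mA.
Qed.

Lemma measurable_minor N k :
  measurable_fun setT (fun t : N.-tuple (measurableTypeR R) => minor k t).
Proof.
by apply: measurable_det => i j; under eq_fun do rewrite mxE; exact: measurable_nth.
Qed.

Lemma measurable_minor1 N k :
  measurable_fun setT (fun t : N.-tuple (measurableTypeR R) => minor1 k t).
Proof.
apply: measurable_det => i j; under eq_fun do rewrite !mxE.
by apply: measurable_funD => //; exact: measurable_nth.
Qed.

Lemma measurable_inv d (T : measurableType d) (u : T -> R) :
  measurable_fun setT u -> measurable_fun setT (fun t => (u t)^-1).
Proof.
(* both sides vanish where $u$ does, since $0^{-1} = 0$ *)
move=> mu; rewrite (_ : (fun t => _) = (fun t => u t * (u t ^+ 2) `^ (-1))).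
  apply: measurable_funM => //; apply: (measurableT_comp (measurable_powR (-1))).
  exact: measurable_funX.
apply/funext => t; rewrite powR_inv1 ?sqr_ge0//.
have [->|u0] := eqVneq (u t) 0; first by rewrite invr0 mul0r.
by field.
Qed.

(** The ratios of consecutive leading minors of $T$ and of $1+T$ are their
    Schur pivots. In these variables the integrand of the theorem is
    multiplicative in the columns; it vanishes as soon as one pivot of $T$ is
    not positive, so that it is supported on the cone. *)
Definition pivot_prod n (a b : nat -> C) (s : seq R) : C :=
  \prod_(j < n) (ppow (minor j.+1 s / minor j s) (a j) *
                 ppow (minor1 j.+1 s / minor1 j s) (b j)).

Lemma pivot_prodS n a b s : pivot_prod n.+1 a b s = pivot_prod n a b s *
  (ppow (minor n.+1 s / minor n s) (a n) * ppow (minor1 n.+1 s / minor1 n s) (b n)).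
Proof. by rewrite /pivot_prod big_ord_recr. Qed.

Lemma tmeasurable_pivot_prod N n a b : tmeasurable N (pivot_prod n a b).
Proof.
apply: cmeasurable_prod => j.
by apply: cmeasurableM; apply: cmeasurable_ppow; apply: measurable_funM;
  (exact: measurable_minor || exact: measurable_minor1 || apply: measurable_inv);
  (exact: measurable_minor || exact: measurable_minor1).
Qed.

Lemma pivot_prod_cat n a b s u : ('C(n.+1, 2) <= size s)%N ->
  pivot_prod n a b (s ++ u) = pivot_prod n a b s.
Proof.
move=> ns; apply: eq_bigr => j _.
have le k : (k <= n)%N -> ('C(k.+1, 2) <= size s)%N.
  by move=> kn; apply: leq_trans ns; exact: leq_bin2l.
have [jS j0] := (le _ (ltn_ord j), le _ (ltnW (ltn_ord j))).
by rewrite /minor /minor1 !symseq_cat.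
Qed.

(** The first pivot at which positivity fails gives the factor zero. *)
Lemma pivot_prod0 n a b s : ~ posdef_matrix (symseq n s) -> pivot_prod n a b s = 0.
Proof.
elim: n => [[]|n IH].
  by split=> [|v]; [exact: tr_symseq|rewrite [v]thinmx0 eqxx].
rewrite pivot_prodS => nP.
have [Pn|/IH ->] := pselect (posdef_matrix (symseq n s)); last by rewrite mul0r.
rewrite ppow_le0 ?mul0r ?mulr0// leNgt; apply/negP => p0; apply: nP.
apply/posdef_symseqS; split => //.
by move: p0; rewrite pmulr_lgt0 ?invr_gt0// minor_gt0.
Qed.

(** Summation by parts in the exponents. *)
Lemma prod_cpow_pivot n (d : nat -> R) (l : nat -> C) :
  (forall j, (j <= n)%N -> 0 < d j) -> d 0%N = 1 ->
  \prod_(j < n) cpow (d j.+1 / d j) (l j) =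
  \prod_(j < n) cpow (d j.+1) (l j - l j.+1) * cpow (d n) (l n).
Proof.
move=> + d0; elim: n => [|n IH] dpos; first by rewrite !big_ord0 d0 cpow1l mulr1.
have [dn dS] := (dpos n (leqnSn n), dpos n.+1 (leqnn _)).
rewrite !big_ord_recr/= IH; last by move=> j jn; apply: dpos; rewrite leqW.
rewrite cpowM ?invr_gt0// cpowVl// -!mulrA; congr (_ * _).
have e : cpow (d n) (l n) * cpow (d n) (- l n) = 1.
  by rewrite cpowN mulfV ?cpow_neq0.
have e' : cpow (d n.+1) (l n - l n.+1) * cpow (d n.+1) (l n.+1) =
    cpow (d n.+1) (l n) by rewrite -cpowD subrK.
by rewrite e' mulrCA e mulr1.
Qed.

Lemma prod_cpow_pivot_cst n (d : nat -> R) (c : C) :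
  (forall j, (j <= n)%N -> 0 < d j) -> d 0%N = 1 ->
  \prod_(j < n) cpow (d j.+1 / d j) c = cpow (d n) c.
Proof.
move=> dpos d0; rewrite (prod_cpow_pivot (fun=> c))// big1 ?mul1r// => j _.
by rewrite subrr cpow_x0.
Qed.

Lemma pivot_prodE n a b s : posdef_matrix (symseq n s) ->
  pivot_prod n a b s = \prod_(j < n) cpow (minor j.+1 s / minor j s) (a j) *
    \prod_(j < n) cpow (minor1 j.+1 s / minor1 j s) (b j).
Proof.
move=> sp; rewrite -big_split; apply: eq_bigr => j _ /=.
have Pj := posdef_symseq_le (ltnW (ltn_ord j)) sp.
have PjS := posdef_symseq_le (ltn_ord j) sp.
by rewrite !ppowE// divr_gt0 ?minor_gt0 ?minor1_gt0.
Qed.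

Lemma pivot_prod_shift n a b s (c e : C) : posdef_matrix (symseq n s) ->
  pivot_prod n (fun j => a j + c) (fun j => b j + e) s =
  pivot_prod n a b s * (cpow (minor n s) c * cpow (minor1 n s) e).
Proof.
move=> sp; have dpos j : (j <= n)%N -> 0 < minor j s.
  by move=> jn; exact/minor_gt0/(posdef_symseq_le jn).
have epos j : (j <= n)%N -> 0 < minor1 j s.
  by move=> jn; exact/minor1_gt0/(posdef_symseq_le jn).
rewrite !pivot_prodE//.
rewrite -(prod_cpow_pivot_cst (d := fun j => minor j s) c dpos (minor0 s)).
rewrite -(prod_cpow_pivot_cst (d := fun j => minor1 j s) e epos (minor10 s)).
have splitD (p : nat -> R) (l : nat -> C) (k : C) : \prod_(j < n) cpow (p j) (l j + k) =
    \prod_(j < n) cpow (p j) (l j) * \prod_(j < n) cpow (p j) k.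
  by rewrite -big_split; apply: eq_bigr => j _; rewrite cpowD.
by rewrite (splitD (fun j => minor j.+1 s / minor j s))
  (splitD (fun j => minor1 j.+1 s / minor1 j s)) mulrACA.
Qed.

(** The integral over the last column is a constant times
    $\det S^{1/2}\det(1+S)^{1/2}$, where $S$ is the remaining block. Both
    determinants are products of pivots, so the integral over $S$ is of the
    same kind, with exponents $a_j + 1/2$ and $b_j + 1/2$: the column $j$ has
    received $n-1-j$ such shifts when its turn comes. *)
Lemma tcint_pivot_prod n (a b : nat -> C) :
  (forall j, (j < n)%N -> 0 < complex.Re (a j + (n - j.+1)%:R * half + 1)) ->
  (forall j, (j < n)%N -> j%:R / 2 <
     complex.Re (- (b j + (n - j.+1)%:R * half) - (a j + (n - j.+1)%:R * half) - 1)) ->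
  tcint 'C(n.+1, 2) (pivot_prod n a b)
    (\prod_(j < n) column_factor j (a j + (n - j.+1)%:R * half) (b j + (n - j.+1)%:R * half)).
Proof.
elim: n a b => [|n IH] a b ha hb.
  have := tcint0 (pivot_prod 0 a b).
  by rewrite /pivot_prod !big_ord0.
have shift (c : nat -> C) j : (j < n)%N ->
    c j + half + (n - j.+1)%:R * half = c j + (n.+1 - j.+1)%:R * half.
  by move=> jn; rewrite subSS -(subnSK jn) -natr1; ring.
have han := ha n (ltnSn n); have hbn := hb n (ltnSn n).
rewrite subnn mul0r !addr0 in han hbn.
pose ra (j : nat) : C := (complex.Re (a j))%:C.
pose rb (j : nat) : C := (complex.Re (b j))%:C.
have inner (c d : nat -> C) s :
    0 < complex.Re (c n + 1) -> n%:R / 2 < complex.Re (- d n - c n - 1) ->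
    size s = 'C(n.+1, 2) -> tcint n.+1 (fun u => pivot_prod n.+1 c d (s ++ u))
      (column_factor n (c n) (d n) *
        pivot_prod n (fun j => c j + half) (fun j => d j + half) s).
  move=> c0 d0 sn.
  have fE u : pivot_prod n.+1 c d (s ++ u) = pivot_prod n c d s *
      (ppow (minor n.+1 (s ++ u) / minor n (s ++ u)) (c n) *
       ppow (minor1 n.+1 (s ++ u) / minor1 n (s ++ u)) (d n)).
    by rewrite pivot_prodS pivot_prod_cat ?sn.
  have [sp|sp] := pselect (posdef_matrix (symseq n s)); last first.
    rewrite pivot_prod0// mulr0; apply: has_cint_eq (has_cint0 _) => u.
    by rewrite fE pivot_prod0// mul0r.
  rewrite pivot_prod_shift// mulrCA; apply: has_cint_eq (has_cintZ _ (tcint_last_column sp c0 d0)) => u.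
  by rewrite fE pivot_cat// pivot1_cat.
have outer (c d : nat -> C) :
    (forall j, (j < n.+1)%N -> 0 < complex.Re (c j + (n.+1 - j.+1)%:R * half + 1)) ->
    (forall j, (j < n.+1)%N -> j%:R / 2 <
     complex.Re (- (d j + (n.+1 - j.+1)%:R * half) - (c j + (n.+1 - j.+1)%:R * half) - 1)) ->
    tcint 'C(n.+1, 2) (fun s => column_factor n (c n) (d n) *
        pivot_prod n (fun j => c j + half) (fun j => d j + half) s)
     (\prod_(j < n.+1) column_factor j (c j + (n.+1 - j.+1)%:R * half)
        (d j + (n.+1 - j.+1)%:R * half)).
  move=> hc hd; rewrite big_ord_recr/= subnn mul0r !addr0 mulrC; apply: has_cintZ.
  rewrite (_ : \prod_(_ < n) _ = \prod_(j < n) column_factor j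
    (c j + half + (n - j.+1)%:R * half) (d j + half + (n - j.+1)%:R * half)); last first.
    by apply: eq_bigr => j _; rewrite !shift.
  by apply: IH => j jn; rewrite !shift//; [apply: hc|apply: hd]; rewrite ltnS ltnW.
have binE : 'C(n.+2, 2) = ('C(n.+1, 2) + n.+1)%N by rewrite binS bin1.
apply: (tcint_cast binE).
refine (tcint_cat (tmeasurable_pivot_prod _ _ _ _) (fun s => inner a b s han hbn)
  (h := fun s => column_factor n (ra n) (rb n) *
        pivot_prod n (fun j => ra j + half) (fun j => rb j + half) s) _
  (outer ra rb _ _) (outer a b ha hb)).
- move=> s sn; apply: has_cint_eq (inner ra rb s _ _ sn) => [u||].
  + rewrite /pivot_prod normr_prod; apply: eq_bigr => j _.
    by rewrite normrM !norm_ppow.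
  + by move: han; rewrite !Re_add.
  + by move: hbn; rewrite !Re_sub !Re_opp.
- by move=> j jn; have := ha j jn; rewrite !Re_add.
- by move=> j jn; have := hb j jn; rewrite !Re_sub !Re_opp !Re_add.
Qed.

End symmetric_matrices.

(** * The integral over the cone *)

Section cone.
Context {R : realType}.
Local Notation C := R[i].

Lemma leading_block_symseq n (t : 'C(n.+1, 2).-tuple (measurableTypeR R)) (j : 'I_n) :
  leading_block (sym_matrix t) j = symseq j.+1 t.
Proof. by apply/matrixP => i k; rewrite !mxE. Qed.

(** With all exponents zero, the product of powers of the pivots is the
    indicator function of the cone. *)
Lemma measurable_posdef_cone n : measurable (posdef_cone R n).
Proof.
pose one := pivot_prod n (fun=> (0 : C)) (fun=> 0).
have -> : posdef_cone R n = (fun t => complex.Re (one (tval t))) @^-1` [set 1].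
  apply/seteqP; split => t /=; rewrite /posdef_cone /= -[sym_matrix t]/(symseq n t).
    move=> tp; rewrite /one pivot_prodE// !big1 ?mul1r// => j _.
      by rewrite cpow_x0.
    by rewrite cpow_x0.
  move=> h; apply: contrapT => tp; move: h; rewrite /one pivot_prod0//= => /eqP.
  by rewrite eq_sym oner_eq0.
have [m1 _] := @tmeasurable_pivot_prod R 'C(n.+1, 2) n (fun=> 0) (fun=> 0).
by rewrite -[X in measurable X]setTI; exact: m1.
Qed.

End cone.

(* The indices k and j start at 0, and lambda`_n = sigma`_n = 0 by the default
   value of the notation s`_i. *)
Theorem mainTheorem1 (R : realType) (n : nat) (n_ge1 : (1 <= n)%N)
    (lambda sigma : n.-tuple R[i])
    (lambda_gt : forall k : 'I_n,
       0 < complex.Re (lambda`_k - (k%:R / 2)%:C))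
    (sigma_gt : forall k : 'I_n,
       0 < complex.Re (sigma`_k - lambda`_k - ((n - k.+1)%:R / 2)%:C)) :
  let F (t : 'C(n.+1, 2).-tuple (measurableTypeR R)) : R[i] :=
    let T := sym_matrix t in
    (\prod_(j < n)
       (cpow (\det (leading_block T j)) (lambda`_j - lambda`_j.+1) /
        cpow (\det (1%:M + leading_block T j)) (sigma`_j - sigma`_j.+1))) *
    cpow (\det T) (- (n.+1%:R / 2)%:C) in
  cintegrable (lebesgue_tuple R 'C(n.+1, 2)) (posdef_cone R n) F /\
  cintegral (lebesgue_tuple R 'C(n.+1, 2)) (posdef_cone R n) F =
  \prod_(k < n)
    ((pi `^ (k%:R / 2))%:C *
     (cGamma (lambda`_k - (k%:R / 2)%:C) *
      cGamma (sigma`_k - lambda`_k - ((n - k.+1)%:R / 2)%:C) /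
      cGamma (sigma`_k - ((n - k.+1)%:R / 2)%:C))).
Proof.
set half : R[i] := (2^-1 : R)%:C.
(* $\det T^{-(n+1)/2}$ is spread over all the pivots *)
pose c : R[i] := - (n.+1%:R / 2)%:C.
pose a (j : nat) : R[i] := lambda`_j + c; pose b (j : nat) : R[i] := - sigma`_j.
have natC m : (m%:R / 2 : R)%:C = m%:R * half :> R[i] by rewrite rmorphM rmorph_nat.
have cE j : (j < n)%N -> c + (n - j.+1)%:R * half + 1 = - (j%:R * half).
  move=> jn; have half2 : 1 = 2%:R * half :> R[i].
    by rewrite /half -(rmorph_nat (real_complex R)) -rmorphM mulfV.
  rewrite /c natC.
  have -> : n.+1%:R = (n - j.+1)%:R + j%:R + 2%:R :> R[i].
    by rewrite -!natrD; congr (_%:R); lia.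
  by rewrite [X in _ + X = _]half2; ring.
have aE j : (j < n)%N -> a j + (n - j.+1)%:R * half + 1 = lambda`_j - (j%:R / 2)%:C.
  by move=> jn; rewrite /a -!addrA (addrA c) cE// natC.
have bE j : - (b j + (n - j.+1)%:R * half) = sigma`_j - ((n - j.+1)%:R / 2)%:C.
  by rewrite /b opprD opprK natC.
have abE j : (j < n)%N ->
    - (b j + (n - j.+1)%:R * half) - (a j + (n - j.+1)%:R * half) - 1 - j%:R * half =
    sigma`_j - lambda`_j - ((n - j.+1)%:R / 2)%:C.
  move=> jn; rewrite bE -(addrA _ (- (a j + _)) (- 1)) -opprD aE// natC.
  by rewrite natC; ring.
have int : tcint 'C(n.+1, 2) (pivot_prod n a b) (\prod_(k < n)
    ((pi `^ (k%:R / 2))%:C *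
     (cGamma (lambda`_k - (k%:R / 2)%:C) *
      cGamma (sigma`_k - lambda`_k - ((n - k.+1)%:R / 2)%:C) /
      cGamma (sigma`_k - ((n - k.+1)%:R / 2)%:C)))).
  rewrite (_ : \prod_(_ < n) _ = \prod_(j < n)
      column_factor j (a j + (n - j.+1)%:R * half) (b j + (n - j.+1)%:R * half)); last first.
    apply: eq_bigr => j _; rewrite /column_factor abE// aE// bE -natC cpow_real//.
    exact: pi_gt0.
  apply: tcint_pivot_prod => j jn.
    by rewrite aE//; exact: (lambda_gt (Ordinal jn)).
  have := sigma_gt (Ordinal jn); rewrite /= -abE// -(natC j) Re_sub.
  by rewrite subr_gt0.
move=> F; apply: (has_cint_restrict _ _ _ int).
- exact: measurable_posdef_cone.
- move=> t; rewrite /posdef_cone/= -[sym_matrix t]/(symseq n t) => tp.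
  have dpos j : (j <= n)%N -> 0 < minor j t.
    by move=> jn; exact/minor_gt0/(posdef_symseq_le jn).
  have epos j : (j <= n)%N -> 0 < minor1 j t.
    by move=> jn; exact/minor1_gt0/(posdef_symseq_le jn).
  have tail (s : n.-tuple R[i]) : s`_n = 0 by rewrite nth_default ?size_tuple.
  have -> : pivot_prod n a b t =
      pivot_prod n (fun j => lambda`_j) b t * cpow (minor n t) c.
    have := pivot_prod_shift (fun j => lambda`_j) b c 0 tp.
    by rewrite cpow_x0 mulr1 => <-; apply: eq_bigr => j _; rewrite addr0.
  rewrite /F pivot_prodE//; congr (_ * _).
  rewrite (prod_cpow_pivot (fun j => lambda`_j) dpos (minor0 _)).
  rewrite (prod_cpow_pivot b epos (minor10 _)).
  rewrite /b !tail oppr0 !cpow_x0 !mulr1 -big_split; apply: eq_bigr => j _ /=.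
  rewrite leading_block_symseq -/(minor _ _) -/(minor1 _ _) -cpowN; congr (_ * cpow _ _).
  by rewrite opprK opprB addrC.
- move=> t; rewrite /posdef_cone/= -[sym_matrix t]/(symseq n t) => tp.
  exact: pivot_prod0.
Qed.
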